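(* Let $n\ge2$, let $X\subseteq\mathbb{R}^n$ be open, $V\subseteq\mathbb{R}^m$, and let $F\colon X\times V\to\mathbb{R}^n$ be continuous and continuously differentiable with respect to its first argument; assume that for any $x_0\in X$ and any admissible input signal $v\in\mathcal{V}$ the solution of the initial value problem $\dot x=F(x,v)$, $x(0)=x_0$, is extendable to the entire time axis $\mathbb{R}_+$. Let, in addition, $F$ be of class $C^2$ with respect to its first argument, and let $\varphi$ denote the general solution of $\dot x=F(x,v)$. Let $t>0$, $r>0$, and let $\Omega\subseteq X$ be $r$-convex with $\Omega\neq\mathbb{R}^n$. Assume further that there is a constant $L_2$ such that $$\left\|\int_0^\delta D_2\varphi(\tau,x,v)^{-1}D_1^2F(p(\tau),v(\tau))\left(D_2\varphi(\tau,x,v)h\right)^2d\tau\right\|\le L_2\|h\|^2$$ for all $x\in\Omega$, $\delta\in[0,t]$, $v\in\mathcal{V}$ and $h\in\mathbb{R}^n$, where $p(\tau)=\varphi(\tau,x,v)$. Then the attainable set $\varphi(\tau,\Omega,v)$ is convex for all $\tau\in[0,t]$ and all admissible input signals $v\in\mathcal{V}$ if $rL_2\le1$.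
   Context: Admissible inputs: a sampling period $T>0$ and a set $U$ of piecewise continuous maps $[0,T]\to V$ are given. $\mathcal{V}$ is the set of admissible input signals, i.e. of all maps $v\colon\mathbb{R}_+\to V$ for which there is a sequence $u\colon\mathbb{Z}_+\to U$ with $v(t)=u_k(t-kT)$ for all $k\in\mathbb{Z}_+$ and all $t\in[kT,(k+1)T[$. Here $\mathbb{R}_+=[0,\infty[$ and $\mathbb{Z}_+=\{0,1,2,\dots\}$. The general solution $\varphi$ of $\dot x=F(x,v)$: $\varphi(t,x_0,v)$ is the value at time $t$ of the ($X$-valued) solution of $\dot x(t)=F(x(t),v(t))$, $x(0)=x_0$. $\varphi(\tau,\Omega,v)=\{\varphi(\tau,x,v):x\in\Omega\}$. $D_i^jf$ is the partial derivative of order $j$ of $f$ with respect to its $i$th argument ($D_i=D_i^1$); for a bilinear map $B$, $Bh^2=B(h,h)$. ''Of class $C^k$ with respect to its first argument'' means that the partial derivatives of $F$ with respect to the first argument up to order $k$ exist and are continuous on $X\times V$. $\|\cdot\|$ is the Euclidean norm. A set $\Omega\subseteq\mathbb{R}^n$ is $r$-convex ($r>0$) if it is the intersection of a family of closed Euclidean balls of radius $r$. *)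

(* Defs.v *)
From mathcomp Require Export all_boot all_order all_algebra.
From mathcomp Require Export all_classical all_reals all_analysis.
Export Order.TTheory GRing.Theory Num.Theory.
Export numFieldNormedType.Exports.

Set Implicit Arguments.
Unset Strict Implicit.
Unset Printing Implicit Defensive.

Local Open Scope classical_set_scope.
Local Open Scope ring_scope.

(* The library norm on ['rV_n] is the max norm (it induces the same topology
   and differentials), so the Euclidean one is defined here. *)
Definition enorm (R : realType) (n : nat) (x : 'rV[R]_n) : R :=
  Num.sqrt (\sum_i x ord0 i ^+ 2).

Definition eball (R : realType) (n : nat) (c : 'rV[R]_n) (r : R) :
  set 'rV[R]_n := [set x | enorm (x - c) <= r].

(* All balls have the same radius, so a family of balls is given by the set
   [C] of its centres; the empty family yields the whole space. *)
Definition r_convex (R : realType) (n : nat) (r : R) (A : set 'rV[R]_n) : Prop :=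
  exists C : set 'rV[R]_n, A = \bigcap_(c in C) eball c r.

(* [u] restricts to a piecewise continuous map [[0,T] -> V]: finitely many
   discontinuities, and one-sided limits everywhere, these limits being points
   of the codomain [V].  Values at the discontinuities are arbitrary points
   of [V]; values outside [[0,T]] are irrelevant. *)
Definition piecewise_continuous (R : realType) (m : nat) (V : set 'rV[R]_m)
    (T : R) (u : R -> 'rV[R]_m) : Prop :=
  [/\ forall t, 0 <= t <= T -> V (u t),
      exists s : seq R, forall t, 0 < t < T -> t \notin s ->
        {for t, continuous u},
      forall t, 0 <= t < T -> exists2 l, V l & u x @[x --> t^'+] --> l
    & forall t, 0 < t <= T -> exists2 l, V l & u x @[x --> t^'-] --> l].

(* Signals are maps on [[0,+oo[]; their values at negative times are
   irrelevant. *)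
Definition admissible (R : realType) (m : nat) (T : R)
    (U : set (R -> 'rV[R]_m)) : set (R -> 'rV[R]_m) :=
  [set v | exists u : nat -> R -> 'rV[R]_m, (forall k, U (u k)) /\
     forall (k : nat) (t : R), k%:R * T <= t < k.+1%:R * T ->
       v t = u k (t - k%:R * T)].

(* Since [v] may jump, the differential equation is required at the positive
   times at which [v] is continuous; an admissible [v] has only finitely many
   discontinuities in any bounded interval, and [x] is continuous across
   them. *)
Definition is_solution (R : realType) (n m : nat) (X : set 'rV[R]_n)
    (F : 'rV[R]_n -> 'rV[R]_m -> 'rV[R]_n) (x0 : 'rV[R]_n)
    (v : R -> 'rV[R]_m) (x : R -> 'rV[R]_n) : Prop :=
  [/\ x 0 = x0,
      forall t, 0 <= t -> X (x t),
      {within `[0, +oo[, continuous x}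
    & forall t, 0 < t -> {for t, continuous v} ->
        is_derive t 1 x (F (x t) (v t))].

(* Meaningful when a solution on [[0,+oo[] exists, for [0 <= t]. *)
Definition general_solution (R : realType) (n m : nat) (X : set 'rV[R]_n)
    (F : 'rV[R]_n -> 'rV[R]_m -> 'rV[R]_n)
    (t : R) (x0 : 'rV[R]_n) (v : R -> 'rV[R]_m) : 'rV[R]_n :=
  xget (fun=> 0) [set x | is_solution X F x0 v x] t.

(* Derivatives are Frechet derivatives.  Vectors are rows, hence
   [D1 F x w] acts as [h |-> h *m D1 F x w]. *)
Definition D1 (R : realType) (n m : nat)
    (F : 'rV[R]_n -> 'rV[R]_m -> 'rV[R]_n)
    (x : 'rV[R]_n) (w : 'rV[R]_m) : 'M[R]_n := 'J (F ^~ w) x.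

(* [D11 F x w h] is the matrix of [k |-> D_1^2 F(x,w)(h,k)]. *)
Definition D11 (R : realType) (n m : nat)
    (F : 'rV[R]_n -> 'rV[R]_m -> 'rV[R]_n)
    (x : 'rV[R]_n) (w : 'rV[R]_m) (h : 'rV[R]_n) : 'M[R]_n :=
  'd (fun y : 'rV[R]_n => D1 F y w) x h.

Definition C1_fst (R : realType) (n m : nat) (X : set 'rV[R]_n)
    (V : set 'rV[R]_m) (F : 'rV[R]_n -> 'rV[R]_m -> 'rV[R]_n) : Prop :=
  (forall x w, X x -> V w -> differentiable (F ^~ w) x) /\
  {within X `*` V, continuous (fun z : 'rV[R]_n * 'rV[R]_m => D1 F z.1 z.2)}.

(* Continuity of [D_1^2 F] in operator norm is, in finite dimension, continuity
   of [D11 F x w h] in [(x,w)] for every [h]. *)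
Definition C2_fst (R : realType) (n m : nat) (X : set 'rV[R]_n)
    (V : set 'rV[R]_m) (F : 'rV[R]_n -> 'rV[R]_m -> 'rV[R]_n) : Prop :=
  [/\ C1_fst X V F,
      forall x w, X x -> V w ->
        differentiable (fun y : 'rV[R]_n => D1 F y w) x
    & forall h : 'rV[R]_n, {within X `*` V,
        continuous (fun z : 'rV[R]_n * 'rV[R]_m => D11 F z.1 z.2 h)}].

Definition vintegral (R : realType) (n : nat) (a b : R) (g : R -> 'rV[R]_n) :
    'rV[R]_n :=
  \row_i (\int[@lebesgue_measure R]_(s in `[a, b]) (g s ord0 i))%R.

(* Main.v *)
Require Import Defs.
From mathcomp Require Import ring lra.

(** Fix the signal [v] and the time [tau], and write [Phi] for the flow map
    [phi tau _ v].  Let [g] be the preimage under [Phi], as far as it exists, of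
    the segment joining two points of [Phi (Omega)].  Then [DPhi (g) g'] is
    constant, that is [g'' = - Q (g) (g')], where
    [Q (x) h = DPhi (x)^-1 D^2Phi (x) (h, h)].  Differentiating the variational
    equation identifies [Q (x) h] with the integral of the hypothesis, so
    [|g''| <= L2 |g'|^2] while [g] is in [Omega].  For a ball of radius [r] and
    centre [c] that contains [Omega], this yields
    [(|g - c|^2)'' = 2 |g'|^2 + 2 (g - c, g'') >= 2 |g'|^2 (1 - r L2) >= 0],
    so [|g - c|^2] is convex along [g] and is maximal at an end point: [g] cannot
    leave the ball.  Since [Omega] is the intersection of such balls, [g] cannot
    leave [Omega].

    The proof makes this rigorous without second derivatives of the flow.  The
    only information used about [Phi] is that it is injective and differentiable
    with invertible differential [M], and that
    [Phi (x + h) - Phi (x) = (h + Q (x) h / 2) M + o (|h|^2)].  The latter is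
    obtained in [flow_second_order] by comparing, through [gronwall], the
    difference of two trajectories with the solution of a forced variational
    equation; the variational equation itself is solved in
    [variational_vector] by a limit of difference quotients of trajectories.
    All the bounds are uniform in time because an admissible signal has
    one-sided limits in [V], so that a trajectory together with its signal stays
    in a compact part of [X * V] ([regulated_cover]).

    The geometric part is [convex_image].  The curve [g] exists locally because
    a differentiable injective map with invertible differential is locally onto
    ([local_surjectivity]), and globally by moving one end point of the segment
    by small steps ([segment_in_image]).  The second-order expansion shows that
    [|g - c|] has no local maximum inside the segment
    ([segment_preimage_ball]).  Absorbing the [o (|h|^2)] needs a strict
    inequality, so the argument is run for the intersection of the balls of a
    smaller radius [rho < r], for which [rho L2 < 1], and into which any two
    points of [Omega] are moved by a contraction towards their midpoint. *)

Set Implicit Arguments.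
Unset Strict Implicit.
Unset Printing Implicit Defensive.

Local Open Scope classical_set_scope.
Local Open Scope ring_scope.

(** * Limits and derivatives of matrices *)

Section MatrixCoordinates.
Context {R : realType}.

Lemma mx_norm_coord m n (A : 'M[R]_(m, n)) i j : `|A i j| <= `|A|.
Proof.
rewrite [leRHS]/Num.norm /= mx_normrE.
by apply: (le_bigmax _ (fun ij : 'I_m * 'I_n => `|A ij.1 ij.2|) (i, j)).
Qed.

Lemma mx_norm_le m n (A : 'M[R]_(m, n)) (e : R) :
  0 <= e -> (forall i j, `|A i j| <= e) -> `|A| <= e.
Proof.
move=> e0 Ae; rewrite [leLHS]/Num.norm /= mx_normrE.
by apply: bigmax_le => // -[i j] _; exact: Ae.
Qed.

Lemma mx_norm_mul m n p (A : 'M[R]_(m, n)) (B : 'M[R]_(n, p)) :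
  `|A *m B| <= n%:R * (`|A| * `|B|).
Proof.
apply: mx_norm_le => [|i j]; first by rewrite !mulr_ge0.
rewrite mxE (le_trans (ler_norm_sum _ _ _))//.
have -> : n%:R * (`|A| * `|B|) = \sum_(k < n) (`|A| * `|B|).
  by rewrite sumr_const card_ord mulr_natl.
apply: ler_sum => k _; rewrite normrM.
by rewrite ler_pM// mx_norm_coord.
Qed.

Lemma cvg_mxP (T : Type) (F : set_system T) (FF : Filter F) m n
    (f : T -> 'M[R]_(m, n)) (l : 'M[R]_(m, n)) :
  (f x @[x --> F] --> l) <-> (forall i j, f x i j @[x --> F] --> l i j).
Proof.
split=> [fl i j|fl].
  exact: (cvg_comp _ _ fl (@coord_continuous _ _ _ i j l)).
apply/cvgrPdist_le => e e0.
have : \forall x \near F, forall ij : 'I_m * 'I_n,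
    `|l ij.1 ij.2 - f x ij.1 ij.2| <= e.
  by apply: filter_forall => -[i j]; move/cvgrPdist_le : (fl i j); exact.
apply: filterS => x H; apply: mx_norm_le => [|i j]; first exact: ltW.
by rewrite !mxE; exact: (H (i, j)).
Qed.

Lemma cvg_mulmx (T : Type) (F : set_system T) (FF : Filter F) m n p
    (f : T -> 'M[R]_(m, n)) (g : T -> 'M[R]_(n, p))
    (a : 'M[R]_(m, n)) (b : 'M[R]_(n, p)) :
  f x @[x --> F] --> a -> g x @[x --> F] --> b ->
  f x *m g x @[x --> F] --> a *m b.
Proof.
move=> /cvg_mxP fa /cvg_mxP gb; apply/cvg_mxP => i j; rewrite mxE.
under eq_fun do rewrite mxE.
apply: cvg_big => [|k _]; [exact: add_continuous|exact: cvgM].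
Qed.

Lemma cvg_det (T : Type) (F : set_system T) (FF : Filter F) n
    (f : T -> 'M[R]_n) (a : 'M[R]_n) :
  f x @[x --> F] --> a -> \det (f x) @[x --> F] --> \det a.
Proof.
move=> /cvg_mxP fa; apply: cvg_big => [|s _]; first exact: add_continuous.
apply: cvgM; first exact: cvg_cst.
apply: cvg_big => [|i _]; [exact: mul_continuous|exact: fa].
Qed.

Lemma cvg_invmx (T : Type) (F : set_system T) (FF : Filter F) n
    (f : T -> 'M[R]_n) (a : 'M[R]_n) : (\forall x \near F, f x \in unitmx) ->
  a \in unitmx -> f x @[x --> F] --> a ->
  invmx (f x) @[x --> F] --> invmx a.
Proof.
move=> fu au fa.
have : ((\det (f x))^-1 *: \adj (f x)) @[x --> F] --> invmx a.
  rewrite /invmx au; apply: cvgZ.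
    by apply: cvgV; [rewrite -unitfE|exact: cvg_det].
  apply/cvg_mxP => i j; rewrite mxE; under eq_fun do rewrite mxE.
  apply: cvgM; first exact: cvg_cst.
  apply: cvg_det; apply/cvg_mxP => k l.
  by rewrite !mxE; under eq_fun do rewrite !mxE; move/cvg_mxP : fa; exact.
apply: cvg_trans; apply: near_eq_cvg.
by apply: filterS fu => x xu; rewrite /invmx xu.
Qed.

Lemma is_derive_mxP m n (f : R -> 'M[R]_(m, n)) (t : R) (d : 'M[R]_(m, n)) :
  is_derive t 1 f d <-> forall i j, is_derive t 1 (fun x => f x i j) (d i j).
Proof.
split=> [fd i j|fd].
  have df := @ex_derive _ _ _ _ _ _ _ fd; move/derivable_mxP : (df) => H.
  apply: DeriveDef; first exact: H.
  by have := @derive_val _ _ _ _ _ _ _ fd; rewrite derive_mx// => <-; rewrite mxE.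
have df : derivable f t 1.
  by apply/derivable_mxP => i j; exact: (@ex_derive _ _ _ _ _ _ _ (fd i j)).
apply: DeriveDef => //; rewrite derive_mx//; apply/matrixP => i j; rewrite mxE.
exact: (@derive_val _ _ _ _ _ _ _ (fd i j)).
Qed.

End MatrixCoordinates.
(** * Primitives with finitely many exceptional points *)

(** The finite set [s] of exceptional times is part of the data: it will be the
    set of discontinuities of the signal, shared by all the functions derived
    from trajectories, so that limits of such functions have the same [s]. *)
Definition primitive_on (R : realType) (V : normedModType R) (s : seq R)
    (a b : R) (f df : R -> V) :=
  {within `[a, b], continuous f} /\
  (forall t, a < t < b -> t \notin s -> is_derive t 1 f (df t)).

Section Primitives.
Context {R : realType}.
Implicit Types (s : seq R) (a b c d t : R).

Lemma within_itv_continuous (W : topologicalType) a b (f : R -> W) t :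
  {within `[a, b], continuous f} -> a < t < b -> f y @[y --> t] --> f t.
Proof.
move=> cf tab.
have h : {within `]a, b[, continuous f}.
  by apply: continuous_subspaceW cf; exact: subset_itv_oo_cc.
move: h; rewrite continuous_open_subspace; last exact: interval_open.
by apply; rewrite inE /= in_itv.
Qed.

Lemma within_itv_bounded m n b (f : R -> 'M[R]_(m, n)) : 0 <= b ->
  {within `[0, b], continuous f} ->
  exists B, forall t, 0 <= t <= b -> `|f t| <= B.
Proof.
move=> b0 cf.
have cn : {within `[0, b], continuous (fun t => `|f t|)}.
  by move=> t; apply: cvg_norm; exact: cf.
have [c _ H] := EVT_max b0 cn.
by exists `|f c| => t tb; apply: H; rewrite in_itv.
Qed.

Lemma primitive_onW (V : normedModType R) s a b c d (f df : R -> V) :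
  a <= c -> d <= b -> primitive_on s a b f df -> primitive_on s c d f df.
Proof.
move=> ac db [cf df_]; split.
  apply: continuous_subspaceW cf => x /=; rewrite !in_itv /= => /andP[cx xd].
  by rewrite (le_trans ac)//= (le_trans xd).
move=> t /andP[ct td]; apply: df_.
by rewrite (le_lt_trans ac)//= (lt_le_trans td).
Qed.

Lemma eq_primitive_on (V : normedModType R) s a b (f df dg : R -> V) :
  (forall t, a < t < b -> df t = dg t) ->
  primitive_on s a b f df -> primitive_on s a b f dg.
Proof.
by move=> e [cf H]; split=> // t tab ts; rewrite -e//; exact: H.
Qed.

Lemma primitive_onD (V : normedModType R) s a b (f g df dg : R -> V) :
  primitive_on s a b f df -> primitive_on s a b g dg ->
  primitive_on s a b (fun t => f t + g t) (fun t => df t + dg t).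
Proof.
move=> [cf Hf] [cg Hg]; split=> [x|t tab ts].
  by apply: (@continuousD _ _ _ (f : subspace _ -> V) g x); [exact: cf|exact: cg].
by apply: is_deriveD; [exact: Hf|exact: Hg].
Qed.

Lemma primitive_onN (V : normedModType R) s a b (f df : R -> V) :
  primitive_on s a b f df ->
  primitive_on s a b (fun t => - f t) (fun t => - df t).
Proof.
move=> [cf Hf]; split=> [x|t tab ts].
  by apply: (@continuousN _ _ _ (f : subspace _ -> V) x); exact: cf.
by apply: is_deriveN; exact: Hf.
Qed.

Lemma primitive_onB (V : normedModType R) s a b (f g df dg : R -> V) :
  primitive_on s a b f df -> primitive_on s a b g dg ->
  primitive_on s a b (fun t => f t - g t) (fun t => df t - dg t).
Proof.
by move=> pf pg; apply: primitive_onD => //; exact: primitive_onN.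
Qed.

Lemma primitive_onZ (V : normedModType R) s a b (k : R) (f df : R -> V) :
  primitive_on s a b f df ->
  primitive_on s a b (fun t => k *: f t) (fun t => k *: df t).
Proof.
move=> [cf Hf]; split=> [x|t tab ts].
  by apply: cvgZl_tmp; exact: cf.
by apply: is_deriveZ; exact: Hf.
Qed.

Lemma primitive_on_cst (V : normedModType R) s a b (k : V) :
  primitive_on s a b (fun=> k) (fun=> 0).
Proof.
split=> [x|t tab ts]; [exact: cvg_cst|exact: is_derive_cst].
Qed.

Lemma primitive_on_id s a b : primitive_on s a b (@id R) (fun=> 1).
Proof.
split=> [|t tab ts]; last exact: is_derive_id.
by apply: continuous_subspaceT => x; exact: cvg_id.
Qed.

Lemma primitive_onM s a b (f g df dg : R -> R) :
  primitive_on s a b f df -> primitive_on s a b g dg ->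
  primitive_on s a b (fun t => f t * g t) (fun t => df t * g t + f t * dg t).
Proof.
move=> [cf Hf] [cg Hg]; split=> [x|t tab ts].
  by apply: (@continuousM _ _ (f : subspace _ -> R) g x); [exact: cf|exact: cg].
have -> : df t * g t + f t * dg t = f t *: dg t + g t *: df t.
  by rewrite addrC [df t * _]mulrC.
by apply: is_deriveM; [exact: Hf|exact: Hg].
Qed.

Lemma primitive_on_sum (V : normedModType R) s a b n (f df : 'I_n -> R -> V) :
  (forall i, primitive_on s a b (f i) (df i)) ->
  primitive_on s a b (fun t => \sum_i f i t) (fun t => \sum_i df i t).
Proof.
elim: n f df => [|n IH] f df H.
  have -> : (fun t => \sum_(i < 0) f i t) = fun=> 0.
    by apply/funext => t; rewrite big_ord0.
  apply: eq_primitive_on (primitive_on_cst s a b 0) => t _.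
  by rewrite big_ord0.
have -> : (fun t => \sum_(i < n.+1) f i t) =
    fun t => f ord0 t + \sum_(i < n) f (lift ord0 i) t.
  by apply/funext => t; rewrite big_ord_recl.
apply: (@eq_primitive_on _ _ _ _ _
   (fun t => df ord0 t + \sum_(i < n) df (lift ord0 i) t)).
  by move=> t _; rewrite big_ord_recl.
by apply: primitive_onD => //; exact: IH.
Qed.

Lemma primitive_on_mxP m n s a b (f df : R -> 'M[R]_(m, n)) :
  primitive_on s a b f df <->
  (forall i j, primitive_on s a b (fun t => f t i j) (fun t => df t i j)).
Proof.
split=> [[cf Hf] i j|H].
  split=> [x|t tab ts].
    by move: (cf x) => /cvg_mxP; exact.
  by move: (Hf t tab ts) => /is_derive_mxP; exact.
split=> [x|t tab ts].
  apply/cvg_mxP => i j; exact: (H i j).1.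
by apply/is_derive_mxP => i j; exact: (H i j).2.
Qed.

Lemma primitive_on_mulmx m n p s a b (f df : R -> 'M[R]_(m, n))
    (g dg : R -> 'M[R]_(n, p)) :
  primitive_on s a b f df -> primitive_on s a b g dg ->
  primitive_on s a b (fun t => f t *m g t)
    (fun t => df t *m g t + f t *m dg t).
Proof.
move=> /primitive_on_mxP pf /primitive_on_mxP pg.
apply/primitive_on_mxP => i j.
have -> : (fun t => (f t *m g t) i j) = fun t => \sum_k f t i k * g t k j.
  by apply/funext => t; rewrite mxE.
apply: (@eq_primitive_on _ _ _ _ _
    (fun t => \sum_k (df t i k * g t k j + f t i k * dg t k j))).
  by move=> t _; rewrite !mxE -big_split.
by apply: primitive_on_sum => k; exact: primitive_onM.
Qed.

Lemma primitive_on_scale m n s a b (f df : R -> R) (A : 'M[R]_(m, n)) :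
  primitive_on s a b f df ->
  primitive_on s a b (fun t => f t *: A) (fun t => df t *: A).
Proof.
move=> pf; apply/primitive_on_mxP => i j.
have -> : (fun t => (f t *: A) i j) = fun t => f t * A i j.
  by apply/funext => t; rewrite mxE.
apply: eq_primitive_on (primitive_onM pf (primitive_on_cst s a b (A i j))).
by move=> t _; rewrite !mxE mulr0 addr0.
Qed.

(** Induction on the exceptional points: each one that lies inside splits the
    interval. *)
Lemma primitive_on_ge0 s a b (f df : R -> R) : a <= b ->
  primitive_on s a b f df -> (forall t, a < t < b -> 0 <= df t) -> f a <= f b.
Proof.
elim: s a b => [|c s IH] a b ab pf df0.
  have [cf Hf] := pf.
  apply: (@ger0_derive1_le_cc _ f a b) => //.
  - by move=> t; rewrite in_itv /= => tab; case: (Hf t tab isT).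
  - move=> t; rewrite in_itv /= => tab; rewrite derive1E.
    by case: (Hf t tab isT) => _ ->; exact: df0.
  - by rewrite in_itv /= lexx.
  - by rewrite in_itv /= lexx ab.
have [/andP[ac cb]|nc] := boolP (a < c < b).
  apply: (@le_trans _ _ (f c)).
    apply: IH (ltW ac) _ _; last first.
      by move=> t /andP[at_ tc]; apply: df0; rewrite at_ (lt_trans tc).
    have [cf Hf] := primitive_onW (lexx a) (ltW cb) pf.
    split=> // t /andP[at_ tc] ts; apply: Hf; rewrite ?at_ ?tc//.
    by rewrite inE negb_or ts lt_eqF.
  apply: IH (ltW cb) _ _; last first.
    by move=> t /andP[ct tb]; apply: df0; rewrite (lt_trans ac).
  have [cf Hf] := primitive_onW (ltW ac) (lexx b) pf.
  split=> // t /andP[ct tb] ts; apply: Hf; rewrite ?ct ?tb//.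
  by rewrite inE negb_or ts gt_eqF.
apply: IH => //; have [cf Hf] := pf; split=> // t tab ts.
apply: Hf => //; rewrite inE negb_or ts andbT.
by apply: contraNneq nc => <-.
Qed.

Lemma primitive_on_lipschitz m n s a b (f df : R -> 'M[R]_(m, n)) (K : R) :
  a <= b -> primitive_on s a b f df ->
  (forall t, a < t < b -> `|df t| <= K) -> `|f b - f a| <= K * (b - a).
Proof.
move=> ab /primitive_on_mxP pf dfK.
have [->|ab'] := eqVneq a b; first by rewrite !subrr mulr0 normr0.
have {}ab' : a < b by rewrite lt_neqAle ab'.
have K0 : 0 <= K.
  apply: le_trans (normr_ge0 _) (dfK ((a + b) / 2) _).
  by rewrite midf_lt//= midf_lt.
apply: mx_norm_le => [|i j]; first by rewrite mulr_ge0// subr_ge0.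
have pK : primitive_on s a b (fun t => K * t) (fun=> K).
  have := primitive_onZ K (primitive_on_id s a b).
  by apply: eq_primitive_on => t _; rewrite [_ *: _]mulr1.
have dfij t : a < t < b -> `|df t i j| <= K.
  by move=> /dfK; exact/le_trans/mx_norm_coord.
have := primitive_on_ge0 ab (primitive_onD pK (pf i j)).
have := primitive_on_ge0 ab (primitive_onB pK (pf i j)).
rewrite !mxE ler_norml.
have H1 : forall t, a < t < b -> 0 <= K - df t i j.
  by move=> t /dfij; rewrite ler_norml subr_ge0 => /andP[].
have H2 : forall t, a < t < b -> 0 <= K + df t i j.
  by move=> t /dfij; rewrite ler_norml => /andP[]; rewrite lerNl -subr_ge0 opprK addrC.
by move=> /(_ H1) h1 /(_ H2) h2; apply/andP; split; lra.
Qed.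

Lemma primitive_on_dist m n s a b (f df : R -> 'M[R]_(m, n)) (K : R) :
  primitive_on s a b f df -> (forall t, a < t < b -> `|df t| <= K) ->
  forall x y, a <= x <= b -> a <= y <= b -> `|f y - f x| <= K * `|y - x|.
Proof.
move=> pf dfK x y; wlog xy : x y / x <= y.
  move=> H xab yab; have [xy|/ltW yx] := leP x y; first exact: H.
  by rewrite distrC [`|y - x|]distrC H.
move=> /andP[ax xb] /andP[ay yb]; rewrite [`|y - x|]ger0_norm ?subr_ge0//.
apply: primitive_on_lipschitz (primitive_onW ax yb pf) _ => //.
by move=> t /andP[xt ty]; rewrite dfK// (le_lt_trans ax xt) (lt_le_trans ty).
Qed.

Lemma is_derive_small_o m n (f : R -> 'M[R]_(m, n)) t (d : 'M[R]_(m, n)) :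
  (forall e, 0 < e -> \forall h \near (0 : R),
     `|f (t + h) - f t - h *: d| <= e * `|h|) ->
  is_derive t 1 f d.
Proof.
move=> H.
have fd : h^-1 *: (f (h *: (1 : R) + t) - f t) @[h --> 0^'] --> d.
  apply/cvgrPdist_le => e e0; near=> h.
  have h0 : h != 0 by near: h; exact: nbhs_dnbhs_neq.
  have Hh : `|f (t + h) - f t - h *: d| <= e * `|h|.
    by near: h; apply: cvg_within; exact: H.
  rewrite [h%:A]mulr1 [h + t]addrC distrC.
  have -> : h^-1 *: (f (t + h) - f t) - d = h^-1 *: (f (t + h) - f t - h *: d).
    by rewrite [in RHS]scalerBr scalerK.
  by rewrite normrZ normfV ler_pdivrMl ?normr_gt0// mulrC.
apply: DeriveDef; first by apply/cvg_ex; exists d.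
by apply/cvg_lim => //.
Unshelve. all: by end_near. Qed.

(** At a point of continuity of [w], the mean value inequality bounds
    [f j (t + h) - f j t - h *: w t] by [e * |h|] on a neighbourhood that does not
    depend on [j]. *)
Lemma primitive_on_limit m n s b (f df : nat -> R -> 'M[R]_(m, n))
    (u w : R -> 'M[R]_(m, n)) :
  (forall j, primitive_on s 0 b (f j) (df j)) ->
  (forall e, 0 < e -> exists j, forall t, 0 <= t <= b ->
     `|f j t - u t| <= e /\ `|df j t - w t| <= e) ->
  {within `[0, b], continuous u} /\
  ((forall t, 0 < t < b -> t \notin s -> {for t, continuous w}) ->
   primitive_on s 0 b u w).
Proof.
move=> pf lim.
have cu : {within `[0, b], continuous u}.
  apply/subspace_continuousP => t tb; apply/cvgrPdist_le => e e0.
  have e3 : 0 < e / 3 by rewrite divr_gt0.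
  have [j Hj] := lim _ e3; have [cf _] := pf j.
  move/subspace_continuousP : cf => /(_ t tb)/cvgrPdist_le/(_ _ e3).
  have : \forall y \near within `[0, b] (nbhs t), `[0, b]%classic y by exact: withinT.
  apply: filterS2 => y yb fy.
  rewrite /= !in_itv /= in tb yb.
  have [h1 _] := Hj t tb; have [h2 _] := Hj y yb.
  have -> : u t - u y = - (f j t - u t) + (f j t - f j y) + (f j y - u y).
    by apply/matrixP => k l; rewrite !mxE; ring.
  rewrite (le_trans (ler_normD _ _))// (_ : e = e / 3 + e / 3 + e / 3); last by field.
  by rewrite lerD// (le_trans (ler_normD _ _))// lerD// normrN.
split=> // cw; split=> // t tb ts; apply: is_derive_small_o => e e0.
have e2 : 0 < e / 2 by rewrite divr_gt0.
have := cw t tb ts => /cvgrPdist_le/(_ _ e2)/nbhs_ballP[rho /= rho0 wrho].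
have [t0 tb'] := andP tb.
pose sg := Num.min rho (Num.min t (b - t)).
have sg0 : 0 < sg by rewrite !lt_min rho0 t0 subr_gt0.
have Hsg : \forall h \near (0 : R), `|h| < sg.
  by apply/nbhs_norm0P; exists sg.
near=> h.
have hsg : `|h| < sg by near: h.
move: hsg; rewrite !lt_min => /and3P[hr ht hb].
have tI c : `|c - t| <= `|h| -> 0 < c < b.
  move=> ch; have := le_lt_trans ch ht; have := le_lt_trans ch hb.
  by rewrite !ltr_norml => /andP[_ h1] /andP[h2 _]; apply/andP; split; lra.
have key j : (forall t, 0 <= t <= b -> `|df j t - w t| <= e / 2) ->
    `|f j (t + h) - f j t - h *: w t| <= e * `|h|.
  move=> Hj.
  have p1 : primitive_on s 0 b (fun y => f j y - y *: w t) (fun y => df j y - 1 *: w t).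
    by apply: primitive_onB (pf j) _; apply: primitive_on_scale; exact: primitive_on_id.
  have /andP[lo0 _] := tI (t - `|h|) ltac:(by rewrite addrAC subrr add0r normrN normr_id).
  have /andP[_ hib] := tI (t + `|h|) ltac:(by rewrite addrAC subrr add0r normr_id).
  have p2 := primitive_onW (ltW lo0) (ltW hib) p1.
  have := primitive_on_dist p2 (K := e) _ (x := t) (y := t + h).
  have -> : f j (t + h) - (t + h) *: w t - (f j t - t *: w t) =
      f j (t + h) - f j t - h *: w t by apply/matrixP => k l; rewrite !mxE; ring.
  rewrite [t + h - t]addrAC subrr add0r; apply.
  - move=> y /andP[y1 y2]; rewrite scale1r.
    have ych : `|y - t| <= `|h| by rewrite ler_norml; apply/andP; split; lra.
    have h1 : `|df j y - w y| <= e / 2.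
      by apply: Hj; have /andP[? ?] := tI y ych; rewrite !ltW.
    have h2 : `|w t - w y| <= e / 2.
      by apply: wrho; rewrite -ball_normE /= distrC (le_lt_trans ych).
    have -> : df j y - w t = (df j y - w y) - (w t - w y).
      by apply/matrixP => k l; rewrite !mxE; ring.
    by rewrite (splitr e) (le_trans (ler_normB _ _))// lerD.
  - by have := normr_ge0 h => ?; apply/andP; split; lra.
  - by have := ler_norm h; have := ler_norm (- h); rewrite normrN => ? ?; apply/andP; split; lra.
have h0 : `|h| <= `|t + h - t| by rewrite [t + h - t]addrAC subrr add0r.
have thb : 0 <= t + h <= b.
  by have /andP[? ?] := tI (t + h) ltac:(by rewrite [t + h - t]addrAC subrr add0r); rewrite !ltW.
have tb0 : 0 <= t <= b by rewrite !ltW.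
apply/ler_addgt0Pr => de de0.
have de2 : 0 < Num.min (e / 2) (de / 2) by rewrite lt_min e2 divr_gt0.
have [j Hj] := lim _ de2.
have Hj1 y : 0 <= y <= b -> `|f j y - u y| <= de / 2.
  by move=> /Hj[+ _]; rewrite le_min => /andP[].
have Hj2 y : 0 <= y <= b -> `|df j y - w y| <= e / 2.
  by move=> /Hj[_]; rewrite le_min => /andP[].
have -> : u (t + h) - u t - h *: w t =
    (f j (t + h) - f j t - h *: w t) + ((f j t - u t) - (f j (t + h) - u (t + h))).
  by apply/matrixP => k l; rewrite !mxE; ring.
rewrite (le_trans (ler_normD _ _))// lerD ?key// (splitr de).
by rewrite (le_trans (ler_normB _ _))// lerD// Hj1.
Unshelve. all: by end_near. Qed.

End Primitives.
(** * Gronwall's inequality *)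

Section Gronwall.
Context {R : realType}.
Implicit Types (s : seq R) (a b c d t : R).

Lemma primitive_on_expR s a b k :
  primitive_on s a b (fun t => expR (k * t)) (fun t : R => k * expR (k * t)).
Proof.
have H t : is_derive t 1 (fun t => expR (k * t)) (k * expR (k * t)).
  have h1 : is_derive t 1 (fun t : R => k * t) k.
    have := @is_deriveZ _ _ _ id k t 1 1 (is_derive_id _ _).
    by rewrite [_ *: _]mulr1.
  have := is_derive1_comp (is_derive_expR (k * t)) h1.
  by rewrite mulrC.
split=> [|t _ _]; last exact: H.
apply: continuous_subspaceT => t.
by apply: differentiable_continuous; apply/derivable1_diffP; case: (H t).
Qed.

Lemma sqr_norm_coords n (x : 'rV[R]_n) :
  `|x| ^+ 2 <= \sum_i x ord0 i ^+ 2 <= n%:R * `|x| ^+ 2.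
Proof.
have S0 : 0 <= \sum_i x ord0 i ^+ 2 by apply: sumr_ge0 => i _; exact: sqr_ge0.
apply/andP; split.
  rewrite -(sqr_sqrtr S0) lerXn2r ?nnegrE ?sqrtr_ge0//.
  apply: mx_norm_le => [|i j]; first exact: sqrtr_ge0.
  rewrite ord1 -sqrtr_sqr ler_wsqrtr// (bigD1 j)//= lerDl.
  by apply: sumr_ge0 => k _; exact: sqr_ge0.
have -> : n%:R * `|x| ^+ 2 = \sum_(k < n) `|x| ^+ 2.
  by rewrite sumr_const card_ord mulr_natl.
apply: ler_sum => i _; rewrite -real_normK ?num_real// lerXn2r ?nnegrE//.
exact: mx_norm_coord.
Qed.

(** The sum of squares [u] of the coordinates satisfies
    [|u'| <= D * (u + eps^2)], so [(u + eps^2) * exp (- D t)] decreases and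
    [(u + eps^2) * exp (D t)] increases.  The constant does not depend on the
    function. *)
Lemma gronwall n b K : 0 <= K -> exists2 C : R, 0 < C &
  forall s a c (x dx : R -> 'rV[R]_n) eps, 0 <= a -> c <= b -> 0 <= eps ->
    primitive_on s a c x dx ->
    (forall t, a < t < c -> `|dx t| <= K * `|x t| + eps) ->
    forall t1 t2, a <= t1 <= c -> a <= t2 <= c ->
      `|x t2| <= C * (`|x t1| + eps).
Proof.
move=> K0.
pose D := n%:R * (2 * K + 1) : R.
have D0 : 0 <= D by rewrite mulr_ge0// addr_ge0// mulr_ge0.
pose C := (n%:R + 1) * expR (D * `|b|).
have C1 : 1 <= C.
  have e1 : 1 <= expR (D * `|b|) by rewrite -expR0 ler_expR mulr_ge0.
  by rewrite /C -[leLHS]mulr1 ler_pM// lerDr.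
exists C; first exact: lt_le_trans C1.
move=> s a c x dx eps a0 cb eps0 px dxK.
pose u t := \sum_i x t ord0 i ^+ 2.
pose du t := \sum_i (dx t ord0 i * x t ord0 i + x t ord0 i * dx t ord0 i).
have pu : primitive_on s a c u du.
  apply: primitive_on_sum => i; move/primitive_on_mxP : px => /(_ ord0 i) pi.
  exact: primitive_onM.
have duD t : a < t < c -> `|du t| <= D * (u t + eps ^+ 2).
  move=> tac; rewrite (le_trans (ler_norm_sum _ _ _))//.
  have [u1 u2] := andP (sqr_norm_coords (x t)).
  apply: (@le_trans _ _ (\sum_(i < n) (2 * K + 1) * (u t + eps ^+ 2))); last first.
    by rewrite sumr_const card_ord /D -[_ *+ n]mulr_natl mulrA.
  apply: ler_sum => i _.
  have h1 := mx_norm_coord (x t) ord0 i.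
  have h2 := le_trans (mx_norm_coord (dx t) ord0 i) (dxK t tac).
  rewrite (le_trans (ler_normD _ _))// !normrM.
  have h3 : `|dx t ord0 i| * `|x t ord0 i| <= (K * `|x t| + eps) * `|x t|.
    by rewrite ler_pM.
  rewrite -/(u t) in u1 *; have n0 := normr_ge0 (x t).
  have := sqr_ge0 (`|x t| - eps).
  nra.
have mono t1 t2 : a <= t1 -> t1 <= t2 -> t2 <= c ->
    u t2 + eps ^+ 2 <= expR (D * `|b|) * (u t1 + eps ^+ 2) /\
    u t1 + eps ^+ 2 <= expR (D * `|b|) * (u t2 + eps ^+ 2).
  move=> at1 t12 t2c.
  have pu' : primitive_on s t1 t2 (fun t => u t + eps ^+ 2) du.
    have := primitive_onD (primitive_onW at1 t2c pu)
      (primitive_on_cst _ _ _ (eps ^+ 2)).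
    by apply: eq_primitive_on => t _; rewrite addr0.
  have v0 t : 0 <= u t + eps ^+ 2.
    by rewrite addr_ge0 ?sqr_ge0//; apply: sumr_ge0 => i _; exact: sqr_ge0.
  have tb : t2 - t1 <= `|b|.
    have := ler_norm b; lra.
  have eb : expR (D * (t2 - t1)) <= expR (D * `|b|).
    by rewrite ler_expR ler_wpM2l.
  have dub t : t1 < t < t2 -> `|du t| <= D * (u t + eps ^+ 2).
    by move=> /andP[h1 h2]; apply: duD; rewrite (le_lt_trans at1)//= (lt_le_trans h2).
  have inc := primitive_on_ge0 t12
    (primitive_onM pu' (primitive_on_expR s t1 t2 D)).
  have dec := primitive_on_ge0 t12
    (primitive_onN (primitive_onM pu' (primitive_on_expR s t1 t2 (- D)))).
  have {}inc : (u t1 + eps ^+ 2) * expR (D * t1) <=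
               (u t2 + eps ^+ 2) * expR (D * t2).
    apply: inc => t /dub; rewrite ler_norml => /andP[h _].
    rewrite mulrA -mulrDl mulr_ge0 ?expR_ge0//; lra.
  have {}dec : (u t2 + eps ^+ 2) * expR (- D * t2) <=
               (u t1 + eps ^+ 2) * expR (- D * t1).
    rewrite -lerN2; apply: dec => t /dub; rewrite ler_norml => /andP[_ h].
    rewrite mulrA -mulrDl -mulNr mulr_ge0 ?expR_ge0//; lra.
  split.
    apply: le_trans (ler_wpM2r (v0 t1) eb).
    have -> : D * (t2 - t1) = D * t2 + - D * t1 by ring.
    rewrite expRD -mulrA [expR (- D * t1) * _]mulrC.
    rewrite -ler_pdivrMl ?expR_gt0// -expRN.
    by rewrite [leLHS]mulrC -mulNr.
  apply: le_trans (ler_wpM2r (v0 t2) eb).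
  have -> : D * (t2 - t1) = - (D * t1) + D * t2 by ring.
  rewrite expRD -mulrA expRN [expR (D * t2) * _]mulrC ler_pdivlMl ?expR_gt0//.
  by rewrite [leLHS]mulrC.
move=> t1 t2 /andP[at1 t1c] /andP[at2 t2c].
have main : u t2 + eps ^+ 2 <= expR (D * `|b|) * (u t1 + eps ^+ 2).
  have [t12|/ltW t21] := leP t1 t2.
    by have [] := mono _ _ at1 t12 t2c.
  by have [] := mono _ _ at2 t21 t1c.
have [h1 _] := andP (sqr_norm_coords (x t2)).
have [_ h2] := andP (sqr_norm_coords (x t1)).
have n1 := normr_ge0 (x t1).
have C0 : 0 <= C := le_trans ler01 C1.
rewrite -(@ler_pXn2r _ 2%N) ?nnegrE// ?mulr_ge0 ?addr_ge0//.
apply: (@le_trans _ _ (C * (`|x t1| + eps) ^+ 2)); last first.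
  by rewrite exprMn ler_wpM2r ?sqr_ge0// expr2 ler_peMl.
apply: (le_trans h1); rewrite -/(u t2).
apply: (@le_trans _ _ (u t2 + eps ^+ 2)); first by rewrite lerDl sqr_ge0.
apply: (le_trans main).
have -> : C * (`|x t1| + eps) ^+ 2 =
    expR (D * `|b|) * ((n%:R + 1) * (`|x t1| + eps) ^+ 2) by rewrite /C; ring.
apply: ler_wpM2l; first exact: expR_ge0.
rewrite -/(u t1) in h2.
have n0 : 0 <= n%:R :> R by [].
have h3 := mulr_ge0 n0 (sqr_ge0 eps); have h4 := mulr_ge0 n1 eps0.
have h5 := mulr_ge0 n0 h4; have h6 := sqr_ge0 `|x t1|.
nra.
Qed.

End Gronwall.
(** * Admissible signals *)

Section Signals.
Context {R : realType} {m : nat}.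
Implicit Types (V : set 'rV[R]_m) (v u : R -> 'rV[R]_m).

(** What an admissible signal retains on [[0, b]] once the sampling is forgotten.
    One-sided limits in [V] make the image of [[0, b]] relatively compact in [V],
    and [s] contains the discontinuities in [(0, b)]. *)
Definition regulated V (s : seq R) (b : R) v :=
  [/\ forall t, 0 <= t <= b -> V (v t),
      forall t, 0 < t < b -> t \notin s -> {for t, continuous v},
      forall t, 0 <= t < b -> exists2 l, V l & v x @[x --> t^'+] --> l
    & forall t, 0 < t <= b -> exists2 l, V l & v x @[x --> t^'-] --> l].

Lemma shift_at_right (t c : R) : x - c @[x --> t^'+] --> (t - c)^'+.
Proof.
move=> A [e /= e0 eA]; exists e => //= y ye ty.
apply: eA; rewrite /= ?ltrD2r//.
by rewrite opprB addrA subrK.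
Qed.

Lemma shift_at_left (t c : R) : x - c @[x --> t^'-] --> (t - c)^'-.
Proof.
move=> A [e /= e0 eA]; exists e => //= y ye ty.
apply: eA; rewrite /= ?ltrD2r//.
by rewrite opprB addrA subrK.
Qed.

(** Every sampling instant is counted among the exceptional points. *)
Lemma admissible_regulated V T (U : set (R -> 'rV[R]_m)) v b : 0 < T ->
  (forall u, U u -> piecewise_continuous V T u) -> admissible T U v ->
  exists s, regulated V s b v.
Proof.
move=> T0 pcU [u [Uu vu]].
have trP t : 0 <= t -> (Num.truncn (t / T))%:R * T <= t < (Num.truncn (t / T)).+1%:R * T.
  move=> t0; rewrite -ler_pdivlMr// -ltr_pdivrMr//.
  by apply: truncn_itv; rewrite divr_ge0// ltW.
have succT k : k.+1%:R * T = k%:R * T + T by rewrite -natr1 mulrDl mul1r.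
have /choice[sk skP] k : exists s : seq R, forall t, 0 < t < T -> t \notin s ->
    {for t, continuous (u k)}.
  by have [] := pcU _ (Uu k).
pose N := (Num.truncn (b / T)).+1.
exists (flatten [seq k%:R * T :: [seq x + k%:R * T | x <- sk k] | k <- iota 0 N]).
split.
- move=> t /andP[t0 tb]; have tk := trP t t0; rewrite (vu _ _ tk).
  have [+ _ _ _] := pcU _ (Uu (Num.truncn (t / T))); apply.
  by move: tk; rewrite succT => /andP[h1 h2]; rewrite subr_ge0 h1 lerBlDl ltW.
- move=> t /andP[t0 tb] ts; have := trP t (ltW t0).
  set k := Num.truncn (t / T) => /andP[tk1 tk2].
  have kN : (k < N)%N.
    by rewrite ltnS; apply: le_truncn; rewrite ler_pM2r ?invr_gt0// ltW.
  move/flattenP : ts => ts.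
  have tkN : t != k%:R * T.
    apply/eqP => tkE; apply: ts; exists (k%:R * T :: [seq x + k%:R * T | x <- sk k]).
      by apply/mapP; exists k => //; rewrite mem_iota.
    by rewrite tkE inE eqxx.
  have {}tk1 : k%:R * T < t by rewrite lt_neqAle eq_sym tkN.
  have tsk : t - k%:R * T \notin sk k.
    apply/negP => tE; apply: ts; exists (k%:R * T :: [seq x + k%:R * T | x <- sk k]).
      by apply/mapP; exists k => //; rewrite mem_iota.
    by rewrite inE; apply/orP; right; apply/mapP; exists (t - k%:R * T); rewrite ?subrK.
  have cu : {for t - k%:R * T, continuous (u k)}.
    by apply: skP => //; rewrite subr_gt0 tk1 ltrBlDl -succT.
  rewrite /prop_for/= /continuous_at (vu k) ?tk2 ?(ltW tk1)//.
  have : u k (x - k%:R * T) @[x --> t] --> u k (t - k%:R * T).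
    apply: continuous_comp; last exact: cu.
    by apply: continuousB; [exact: cvg_id|exact: cvg_cst].
  apply: cvg_trans; apply: near_eq_cvg; near=> x.
  apply/esym/vu/andP; split; near: x.
    by have := lt_nbhsr tk1; apply: filterS => x; exact: ltW.
  exact: lt_nbhsl.
- move=> t /andP[t0 tb]; have := trP t t0.
  set k := Num.truncn (t / T) => /andP[tk1 tk2].
  have [_ _ + _] := pcU _ (Uu k).
  move=> /(_ (t - k%:R * T)); rewrite subr_ge0 tk1 ltrBlDl -succT tk2.
  move=> /(_ isT)[l Vl ul]; exists l => //.
  have := cvg_comp _ _ (@shift_at_right t (k%:R * T)) ul.
  apply: cvg_trans; apply: near_eq_cvg; near=> x.
  apply/esym/vu/andP; split; near: x.
    by have := nbhs_right_gt t; apply: filterS => x /ltW; exact: le_trans.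
  exact: nbhs_right_lt.
- move=> t /andP[t0 tb].
  have [k /andP[tk1 tk2]] : exists k, k%:R * T < t <= k.+1%:R * T.
    have := trP t (ltW t0).
    case: (Num.truncn (t / T)) => [|k] /andP[tk1 tk2].
      by exists 0%N; rewrite mul0r t0 ltW// -[ltRHS]mul1r.
    have [tE|tN] := eqVneq t (k.+1%:R * T).
      by exists k; rewrite tE lexx ltr_pM2r// ltr_nat ltnSn.
    by exists k.+1; rewrite lt_neqAle eq_sym tN tk1 ltW.
  have [_ _ _ +] := pcU _ (Uu k).
  move=> /(_ (t - k%:R * T)); rewrite subr_gt0 tk1 lerBlDl -succT tk2.
  move=> /(_ isT)[l Vl ul]; exists l => //.
  have := cvg_comp _ _ (@shift_at_left t (k%:R * T)) ul.
  apply: cvg_trans; apply: near_eq_cvg; near=> x.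
  apply/esym/vu/andP; split; near: x.
    by have := nbhs_left_gt tk1; apply: filterS => x; exact: ltW.
  have := nbhs_left_lt t; apply: filterS => x /lt_le_trans; exact.
Unshelve. all: by end_near. Qed.

End Signals.
(** * Uniformity along a trajectory *)

Section Uniformity.
Context {R : realType} {n m : nat}.
Variables (X : set 'rV[R]_n) (V : set 'rV[R]_m).
Hypothesis openX : open X.
Variables (s : seq R) (b : R) (v : R -> 'rV[R]_m) (x : R -> 'rV[R]_n).
Hypothesis regv : regulated V s b v.
Hypothesis contx : {within `[0, b], continuous x}.
Hypothesis xX : forall t, 0 <= t <= b -> X (x t).

(** Compactness of [[0,b]]: the filters [H] that matter at a time [t] are the
    two one-sided neighbourhoods, along which [v] converges in [V], and the
    point [t] itself. *)
Lemma regulated_cover (I : Type) (F : set_system I) (P : I -> R -> Prop) :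
  Filter F ->
  (forall t l (H : set_system R), 0 <= t <= b -> V l -> Filter H ->
     (\forall y \near H, 0 <= y <= b) ->
     x y @[y --> H] --> x t -> v y @[y --> H] --> l ->
     \forall y \near H & i \near F, P i y) ->
  \forall i \near F, forall t, 0 <= t <= b -> P i t.
Proof.
move=> FF HP; have [vV _ vr vl] := regv.
pose D := [set y : R | 0 <= y <= b].
have cvgx t (G : set_system R) : Filter G -> 0 <= t <= b ->
    within D G `=>` within D (nbhs t) -> x y @[y --> within D G] --> x t.
  move=> FG tb GD.
  have := contx; rewrite (_ : `[0, b]%classic = D); last first.
    by apply/seteqP; split=> y; rewrite /= in_itv.
  move=> /subspace_continuousP/(_ t tb) h; apply: cvg_trans h.
  by move=> A; exact: GD.
have [ab|ba] := leP 0 b; last first.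
  apply: nearW => i t /andP[t0 tb]; suff : false by [].
  by move: (le_lt_trans (le_trans t0 tb) ba); rewrite ltxx.
have := @segment_compact R 0 b.
move=> /compact_near_coveringP/near_covering_withinP => /(_ _ F P FF) H.
have {H} : \near F, `[0, b] `<=` P F.
  apply: H => t /=; rewrite in_itv /= => tb.
  have [t0 tb'] := andP tb.
  have [[Up Fp] [/= HUp FFp] subp] :
      \forall y \near globally [set t] & i \near F, P i y.
    apply: (HP t (v t)) => //.
    - exact: vV.
    - by move=> y ->.
    - by move=> A At y ->; exact: (nbhs_singleton At).
    - by move=> A At y ->; exact: (nbhs_singleton At).
  have [[Ur Fr] [/= HUr FFr] subr] :
      \forall y \near within D t^'+ & i \near F, P i y.
    move: tb'; rewrite le_eqVlt => /predU1P[tE|tltb].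
      exists (set0, setT) => //=; last by move=> [y i] [] [].
      split; last exact: filterT.
      suff : t^'+ (fun y => D y -> set0 y) by [].
      by have := nbhs_right_gt t; apply: filterS => y ty /andP[_]; rewrite leNgt -tE ty.
    have [l Vl vtl] := vr t ltac:(by rewrite t0).
    apply: (HP t l) => //.
    - by apply: withinT.
    - apply: cvgx => // A; rewrite /within /= => h.
      by rewrite /at_right /at_left /within /=; apply: filterS h => y hy _; exact: hy.
    - by apply: cvg_trans vtl; apply: cvg_app; exact: cvg_within.
  have [[Ul Fl] [/= HUl FFl] subl] :
      \forall y \near within D t^'- & i \near F, P i y.
    move: t0; rewrite le_eqVlt => /predU1P[tE|tgt0].
      exists (set0, setT) => //=; last by move=> [y i] [] [].
      split; last exact: filterT.
      suff : t^'- (fun y => D y -> set0 y) by [].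
      by have := nbhs_left_lt t; apply: filterS => y yt /andP[+ _]; rewrite leNgt tE yt.
    have [l Vl vtl] := vl t ltac:(by rewrite tgt0).
    apply: (HP t l) => //.
    - by apply: withinT.
    - apply: cvgx => // A; rewrite /within /= => h.
      by rewrite /at_right /at_left /within /=; apply: filterS h => y hy _; exact: hy.
    - by apply: cvg_trans vtl; apply: cvg_app; exact: cvg_within.
  exists ([set y | (t < y -> D y -> Ur y) /\ (y < t -> D y -> Ul y)],
          Fp `&` (Fr `&` Fl)).
    split; last by apply: filterI => //; exact: filterI.
    by apply: filterI; [exact: HUr|exact: HUl].
  move=> [y i] [/= [yr yl] [Fpi [Fri Fli]]]; rewrite in_itv /= => Dy.
  have [ty|yt|<-] := ltgtP t y.
  - by apply: (subr (y, i)); split => //; exact: yr.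
  - by apply: (subl (y, i)); split => //; exact: yl.
  - by apply: (subp (t, i)); split => //; exact: HUp.
by apply: filterS => i Pi t tb; apply: Pi; rewrite /= in_itv.
Unshelve. all: by end_near. Qed.

Section ContinuousDependence.
Variables (W : normedModType R) (G : 'rV[R]_n -> 'rV[R]_m -> W).
Hypothesis contG :
  {within X `*` V, continuous (fun z : 'rV[R]_n * 'rV[R]_m => G z.1 z.2)}.

Let cvgG (T : Type) (H : set_system T) (y : T -> 'rV[R]_n) (w : T -> 'rV[R]_m) p q :
  Filter H -> X p -> V q -> (\forall a \near H, V (w a)) ->
  y a @[a --> H] --> p -> w a @[a --> H] --> q ->
  G (y a) (w a) @[a --> H] --> G p q.
Proof.
move=> FH Xp Vq wV yp wq.
move/subspace_continuousP : contG => /(_ (p, q) (conj Xp Vq)).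
apply: cvg_trans => A /= hA.
have : \forall a \near H, X (y a) by apply: yp; exact: open_nbhs_nbhs.
move=> yX; have : \forall a \near H, (fun z => (X `*` V) z -> A (G z.1 z.2)) (y a, w a).
  by have /(_ _ _ _ _ hA) := cvg_pair yp wq; apply.
rewrite /= /nbhs /=; move: yX wV; apply: filterS3 => a ya wa; apply.
by split.
Qed.

(** [G] is uniformly continuous in its first argument along the trajectory, with
    a radius that serves for all times although [v] jumps. *)
Lemma tube_close (eps : R) : 0 < eps ->
  exists2 eta : R, 0 < eta & forall d t, `|d| < eta -> 0 <= t <= b ->
    X (x t + d) /\ `|G (x t + d) (v t) - G (x t) (v t)| <= eps.
Proof.
move=> e0; have [vV _ _ _] := regv.
suff : \forall d \near (0 : 'rV[R]_n), forall t, 0 <= t <= b ->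
    X (x t + d) /\ `|G (x t + d) (v t) - G (x t) (v t)| <= eps.
  move=> /nbhs_norm0P[eta /= eta0 H]; exists eta => // d t de tb.
  exact: (H d de t tb).
apply: (@regulated_cover _ (nbhs (0 : 'rV[R]_n)) (fun d t =>
  X (x t + d) /\ `|G (x t + d) (v t) - G (x t) (v t)| <= eps)).
move=> t l H tb Vl FH Hb xH vH.
have vHV : \forall a \near H, V (v a) by apply: filterS Hb => y; exact: vV.
have c1 : x z.1 + z.2 @[z --> filter_prod H (nbhs (0 : 'rV[R]_n))] --> x t + 0.
  apply: cvgD; last exact: cvg_snd.
  by apply: cvg_comp xH; exact: cvg_fst.
have c2 : v z.1 @[z --> filter_prod H (nbhs (0 : 'rV[R]_n))] --> l.
  by apply: cvg_comp vH; exact: cvg_fst.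
have c3 : x z.1 @[z --> filter_prod H (nbhs (0 : 'rV[R]_n))] --> x t.
  by apply: cvg_comp xH; exact: cvg_fst.
have vHV' : \forall z \near filter_prod H (nbhs (0 : 'rV[R]_n)), V (v z.1).
  exact: (cvg_fst vHV).
rewrite addr0 in c1.
have FP : Filter (filter_prod H (nbhs (0 : 'rV[R]_n))).
  by apply: filter_prod_filter.
have g1 := cvgG FP (xX tb) Vl vHV' c1 c2.
have g2 := cvgG FP (xX tb) Vl vHV' c3 c2.
have := cvgB g1 g2; rewrite subrr => /(_ FP)/cvgr0Pnorm_le/(_ _ e0) => h.
have hX : \forall z \near filter_prod H (nbhs (0 : 'rV[R]_n)), X (x z.1 + z.2).
  by apply: c1; apply: open_nbhs_nbhs; split => //; exact: xX.
by move: h hX; apply: filterS2 => z.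
Qed.

Lemma trajectory_bounded :
  exists2 C : R, 0 <= C & forall t, 0 <= t <= b -> `|G (x t) (v t)| <= C.
Proof.
have [vV _ _ _] := regv.
suff : \forall C \near +oo, forall t, 0 <= t <= b -> `|G (x t) (v t)| <= C.
  move=> h; near (+oo : set_system R) => C.
  by exists C; [near: C; exact: nbhs_pinfty_ge|near: C].
apply: regulated_cover => t l H tb Vl FH Hb xH vH.
have vHV : \forall a \near H, V (v a) by apply: filterS Hb => y; exact: vV.
have := cvgG FH (xX tb) Vl vHV xH vH => /cvgrPdist_le/(_ _ ltr01) h.
exists ([set y | `|G (x t) l - G (x y) (v y)| <= 1], [set C | `|G (x t) l| + 1 <= C]).
  by split => //=; exact: nbhs_pinfty_ge.
move=> [y C] [/= h1 h2].
rewrite (le_trans _ h2)//.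
have -> : G (x y) (v y) = G (x t) l - (G (x t) l - G (x y) (v y)).
  by rewrite opprB addrC subrK.
by rewrite (le_trans (ler_normB _ _))// lerD2l.
Unshelve. all: by end_near. Qed.

Lemma trajectory_continuous t : 0 < t < b -> t \notin s ->
  {for t, continuous (fun t => G (x t) (v t))}.
Proof.
move=> tb ts; have [vV vc _ _] := regv.
have tb' : 0 <= t <= b by case/andP: tb => *; rewrite !ltW.
apply: cvgG => //; [exact: xX|exact: vV| |..].
- near=> y; apply: vV; apply/andP; split; apply: ltW; near: y.
    by apply: lt_nbhsr; case/andP: tb.
  by apply: lt_nbhsl; case/andP: tb.
- exact: within_itv_continuous contx tb.
- exact: vc.
Unshelve. all: by end_near. Qed.

End ContinuousDependence.
End Uniformity.
(** * Exit times and segments *)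

Section Exit.
Context {R : realType}.

Lemma compact_preimage (T U : topologicalType) (A : set T) (f : T -> U)
    (D : set U) : compact A -> {within A, continuous f} -> closed D ->
  compact (A `&` f @^-1` D).
Proof.
move=> cA cf cD.
have : closed (f @^-1` D : set (subspace A)) by apply: preimage_closed => // x _; exact: cf.
move=> /(iffLR (closed_subspaceP _ _))[B cB BE].
rewrite setIC -BE setIC; exact: compact_closedI.
Qed.

Lemma first_exit (g : R -> R) a c eta : a <= c ->
  {within `[a, c], continuous g} -> g a < eta -> eta <= g c ->
  exists2 t, a < t <= c & eta <= g t /\ forall y, a <= y < t -> g y < eta.
Proof.
move=> ac cg ga gc.
pose K := `[a, c] `&` g @^-1` [set y | eta <= y].
have cK : compact K.
  apply: compact_preimage => //; exact: segment_compact.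
have [] := @compact_EVT_min _ R id K _ cK.
- by exists c; split => //=; rewrite in_itv /= ac lexx.
- by apply: continuous_subspaceT => x; exact: cvg_id.
move=> t; rewrite inE => -[/=]; rewrite in_itv /= => /andP[at_ tc] gt tmin.
exists t; last split => //.
  rewrite tc andbT lt_neqAle at_ andbT; apply: contraTneq gt => <-.
  by rewrite -ltNge.
move=> y /andP[ay yt]; rewrite ltNge; apply/negP => gy.
have := tmin y; rewrite inE leNgt yt => /(_ _)/negP; apply => //.
by split => //=; rewrite in_itv /= ay (le_trans (ltW yt)).
Qed.

Lemma last_entry (g : R -> R) a c eta : a <= c ->
  {within `[a, c], continuous g} -> eta <= g a -> g c < eta ->
  exists2 t, a <= t < c & eta <= g t /\ forall y, t < y <= c -> g y < eta.
Proof.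
move=> ac cg ga gc.
pose K := `[a, c] `&` g @^-1` [set y | eta <= y].
have cK : compact K.
  apply: compact_preimage => //; exact: segment_compact.
have [] := @compact_EVT_max _ R id K _ cK.
- by exists a; split => //=; rewrite in_itv /= ac lexx.
- by apply: continuous_subspaceT => x; exact: cvg_id.
move=> t; rewrite inE => -[/=]; rewrite in_itv /= => /andP[at_ tc] gt tmax.
exists t; last split => //.
  rewrite at_ /= lt_neqAle tc andbT; apply: contraTneq gt => ->.
  by rewrite -ltNge.
move=> y /andP[ty yc]; rewrite ltNge; apply/negP => gy.
have := tmax y; rewrite inE leNgt ty => /(_ _)/negP; apply => //.
by split => //=; rewrite in_itv /= yc (le_trans at_ (ltW ty)).
Qed.

End Exit.

Section Segments.
Context {R : realType} {n p q : nat}.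

Lemma is_derive_line (f : 'rV[R]_n -> 'M[R]_(p, q)) (y d : 'rV[R]_n) (k : R) :
  differentiable f (y + k *: d) ->
  is_derive k 1 (fun u : R => f (y + u *: d)) ('d f (y + k *: d) d).
Proof.
move=> df.
have dl : is_diff k (fun u : R => y + u *: d) (fun u : R => u *: d).
  have -> : (fun u : R => u *: d) = (fun=> 0) + ( *:%R^~ d).
    by apply/funext => u; rewrite fctE /= add0r.
  exact: is_diffD.
have dl' : differentiable (fun u : R => y + u *: d) k by [].
have dc : differentiable (f \o (fun u : R => y + u *: d)) k.
  exact: differentiable_comp.
apply: DeriveDef; first exact/derivable1_diffP.
rewrite (_ : (fun u => _) = f \o (fun u : R => y + u *: d))//.
by rewrite deriveE// diff_comp//= diff_val /= scale1r.
Qed.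

Lemma primitive_on_line (f : 'rV[R]_n -> 'M[R]_(p, q)) (y d : 'rV[R]_n) :
  (forall k : R, 0 <= k <= 1 -> differentiable f (y + k *: d)) ->
  primitive_on [::] 0 1 (fun k => f (y + k *: d)) (fun k => 'd f (y + k *: d) d).
Proof.
move=> df; split.
  apply: continuous_in_subspaceT => k; rewrite inE /= in_itv /= => k01.
  apply: differentiable_continuous; apply/derivable1_diffP.
  by case: (is_derive_line (df k k01)).
move=> k /andP[k0 k1] _; apply: is_derive_line; apply: df.
by rewrite !ltW.
Qed.

Lemma mean_value_segment (f : 'rV[R]_n -> 'M[R]_(p, q)) (y d : 'rV[R]_n) L e :
  (forall k : R, 0 <= k <= 1 -> differentiable f (y + k *: d)) ->
  (forall k : R, 0 <= k <= 1 -> `|'d f (y + k *: d) d - L| <= e) ->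
  `|f (y + d) - f y - L| <= e.
Proof.
move=> df dfe.
have p1 := primitive_on_line df.
have p2 := primitive_on_scale L (primitive_on_id [::] 0 1).
have := primitive_on_lipschitz ler01 (primitive_onB p1 p2).
move=> H; have e1 : e = e * (1 - 0) by rewrite subr0 mulr1.
rewrite e1.
have -> : f (y + d) - f y - L = f (y + 1 *: d) - 1 *: L - (f (y + 0 *: d) - 0 *: L).
  by rewrite !scale0r !scale1r addr0 subr0 addrAC.
apply: H.
by move=> k /andP[k0 k1]; rewrite scale1r; apply: dfe; rewrite !ltW.
Qed.

End Segments.
(** * Integrals of piecewise continuous functions *)

Section PiecewiseIntegral.
Context {R : realType}.
Notation mu := (@lebesgue_measure R).

Lemma measurable_fun_finite_exceptions (s : seq R) (D : set R) (f : R -> R) :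
  measurable D -> measurable_fun (D `\` [set` s]) f -> measurable_fun D f.
Proof.
elim: s D => [|c s IH] D mD mf.
  by move: mf; rewrite (_ : [set` [::]] = set0) ?setD0//; apply/seteqP; split.
have mc : measurable [set c] by exact: measurable_set1.
apply: (@measurable_funS _ _ _ _ ((D `\` [set c]) `|` [set c])).
- by apply: measurableU => //; exact: measurableD.
- by move=> x Dx /=; have [->|/eqP xc] := eqVneq x c; [right|left].
apply/measurable_funU => //; first exact: measurableD.
split; last exact: measurable_fun_set1.
apply: IH; first exact: measurableD.
move: mf; congr measurable_fun; apply/seteqP; split=> x /=.
  move=> [Dx /negP]; rewrite inE negb_or => /andP[/eqP xc xs].
  by split; [split|exact/negP].
by move=> [[Dx xc] /negP xs]; split=> //; apply/negP; rewrite inE negb_or xs andbT; apply/eqP.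
Qed.

Lemma integrable_piecewise (s : seq R) (a b B : R) (f : R -> R) :
  (forall t, a < t < b -> t \notin s -> {for t, continuous f}) ->
  (forall t, a <= t <= b -> `|f t| <= B) ->
  mu.-integrable `[a, b] (EFin \o f).
Proof.
move=> cf fB.
apply: measurable_bounded_integrable => //.
- by rewrite /= lebesgue_measure_itv /=; case: ifP => _; rewrite ?ltry// -EFinB ltry.
- apply: (@measurable_fun_finite_exceptions [:: a, b & s]) => //.
  have oU : open (`]a, b[ `\` [set` s]).
    rewrite setDE; apply: openI; first exact: interval_open.
    apply: closed_openC; apply: (iffLR accessible_finite_set_closed).
      exact/hausdorff_accessible/Rhausdorff.
    exact: finite_seq.
  apply: (@measurable_funS _ _ _ _ (`]a, b[ `\` [set` s])).
  + exact: measurable_realfun.open_measurable.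
  + move=> t /= [tab /negP]; rewrite !inE !negb_or => /and3P[ta tb ts].
    split; last exact/negP.
    suff : t \in `]a, b[%R by [].
    move: tab; rewrite !in_itv /= => /andP[h1 h2].
    by rewrite !lt_neqAle h1 h2 eq_sym ta tb.
  + apply: measurable_realfun.open_continuous_measurable_fun => // t; rewrite inE => -[/=].
    by rewrite in_itv /= => tab /negP ts; exact: cf.
- exists B; split; first exact: num_real.
  move=> M BM t /=; rewrite in_itv /= => tab.
  exact: le_trans (fB t tab) (ltW BM).
Qed.

Lemma primitive_on_vintegral n (s : seq R) (b B : R) (g : R -> 'rV[R]_n) :
  (forall t, 0 < t < b -> t \notin s -> {for t, continuous g}) ->
  (forall t, 0 <= t <= b -> `|g t| <= B) ->
  primitive_on s 0 b (fun t => vintegral 0 t g) g.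
Proof.
move=> cg gB; apply/primitive_on_mxP => i j; rewrite ord1 {i}.
have -> : (fun t => vintegral 0 t g ord0 j) =
    (fun t => \int[mu]_(y in `[0, t]) (g y ord0 j))%R.
  by apply/funext => t; rewrite mxE.
have int : mu.-integrable `[0, b] (EFin \o (fun t => g t ord0 j)).
  apply: (@integrable_piecewise s 0 b B) => t tb.
    by move=> ts; have /cvg_mxP := cg t tb ts; exact.
  by apply: le_trans (gB t tb); exact: mx_norm_coord.
have [b0|b0] := leP 0 b; last first.
  split.
    rewrite set_itv_ge; last by rewrite bnd_simp -ltNge.
    exact: continuous_subspace0.
  by move=> t /andP[t0 tb]; move: (lt_trans (lt_trans t0 tb) b0); rewrite ltxx.
split; first exact: parameterized_integral_continuous.
move=> t /andP[t0 tb] ts.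
have ct : {for t, continuous (fun t => g t ord0 j)}.
  by have /cvg_mxP := cg t ltac:(by rewrite t0) ts; exact.
have [d e] := continuous_FTC1_closed tb int t0 ct.
apply: DeriveDef; first exact: d.
by rewrite -derive1E; exact: e.
Qed.

Lemma vintegral0 n (g : R -> 'rV[R]_n) : vintegral 0 0 g = 0.
Proof.
by apply/rowP => j; rewrite !mxE set_itv1 Rintegral_set1.
Qed.

End PiecewiseIntegral.
(** * Dependence of trajectories on the initial value *)

Section Flow.
Context {R : realType} {n m : nat}.
Variables (X : set 'rV[R]_n) (V : set 'rV[R]_m).
Variable F : 'rV[R]_n -> 'rV[R]_m -> 'rV[R]_n.
Hypothesis openX : open X.
Hypothesis C1F : C1_fst X V F.
Variables (s : seq R) (b : R) (v : R -> 'rV[R]_m).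
Hypothesis b0 : 0 <= b.
Hypothesis regv : regulated V s b v.
Implicit Types (t : R) (x : R -> 'rV[R]_n).

(** Restriction to [[0, b]] of a solution of the differential equation; the initial
    value is left free and read off as [x 0]. *)
Definition trajectory x :=
  (forall t, 0 <= t <= b -> X (x t)) /\
  primitive_on s 0 b x (fun t => F (x t) (v t)).

Lemma diff_fst y w d : 'd (F ^~ w) y d = d *m D1 F y w.
Proof. by rewrite /D1 /jacobian mul_rV_lin1. Qed.

Let tube {W : normedModType R} {G : 'rV[R]_n -> 'rV[R]_m -> W} x :
  trajectory x ->
  {within X `*` V, continuous (fun z : 'rV[R]_n * 'rV[R]_m => G z.1 z.2)} ->
  forall eps : R, 0 < eps ->
  exists2 eta : R, 0 < eta & forall d t, `|d| < eta -> 0 <= t <= b ->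
    X (x t + d) /\ `|G (x t + d) (v t) - G (x t) (v t)| <= eps.
Proof. by move=> [xX [cx _]]; apply: (tube_close openX regv cx xX). Qed.

Let bounded {W : normedModType R} {G : 'rV[R]_n -> 'rV[R]_m -> W} x :
  trajectory x ->
  {within X `*` V, continuous (fun z : 'rV[R]_n * 'rV[R]_m => G z.1 z.2)} ->
  exists2 C : R, 0 <= C & forall t, 0 <= t <= b -> `|G (x t) (v t)| <= C.
Proof. by move=> [xX [cx _]]; apply: (trajectory_bounded openX regv cx xX). Qed.

Let n1_gt0 : 0 < n%:R + 1 :> R.
Proof. by rewrite ltr_wpDl. Qed.

Let n1_le (e : R) : 0 <= e -> n%:R * (e / (n%:R + 1)) <= e.
Proof.
move=> e0; rewrite mulrCA ler_piMr// ler_pdivrMr// mul1r lerDl.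
exact: ler01.
Qed.

Let norm_kd (k : R) (d : 'rV[R]_n) : 0 <= k <= 1 -> `|k *: d| <= `|d|.
Proof. by move=> /andP[k0 k1]; rewrite normrZ ger0_norm// ler_piMl. Qed.

Lemma taylor1 x (eps : R) : trajectory x -> 0 < eps ->
  exists2 eta : R, 0 < eta & forall d t, `|d| < eta -> 0 <= t <= b ->
    X (x t + d) /\
    `|F (x t + d) (v t) - F (x t) (v t) - d *m D1 F (x t) (v t)| <= eps * `|d|.
Proof.
move=> tx eps0; have [dF cD] := C1F; have [vV _ _ _] := regv.
have e0 : 0 < eps / (n%:R + 1) by rewrite divr_gt0.
have [eta eta0 H] := tube tx cD e0.
exists eta => // d t de tb; split; first by have [] := H d t de tb.
have kde k : 0 <= k <= 1 -> `|k *: d| < eta.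
  by move=> k01; apply: le_lt_trans de; exact: norm_kd.
apply: (@mean_value_segment _ _ _ _ (F ^~ (v t))) => k k01.
  by apply: dF; [have [] := H _ t (kde k k01) tb|exact: vV].
rewrite diff_fst -mulmxBr (le_trans (mx_norm_mul _ _))//.
have [_ h] := H _ t (kde k k01) tb.
rewrite mulrCA mulrC ler_wpM2r// (le_trans _ (n1_le (ltW eps0)))//.
by rewrite ler_wpM2l.
Qed.

(** Near [x], the difference of two trajectories obeys a linear differential
    inequality, so Gronwall controls it as long as it stays in the tube; the
    resulting bound keeps it there. *)
Lemma flow_lipschitz x : trajectory x ->
  exists eta C : R, [/\ 0 < eta, 0 < C & forall x', trajectory x' ->
    forall t0 t, 0 <= t0 <= b -> 0 <= t <= b ->
      `|x' t0 - x t0| < eta -> `|x' t - x t| <= C * `|x' t0 - x t0| ].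
Proof.
move=> tx; have [dF cD] := C1F.
have [K K0 HK] := bounded tx cD.
have [eta eta0 H] := taylor1 tx ltr01.
have [C C0 gron] := gronwall n b (addr_ge0 (mulr_ge0 (ler0n R n) K0) ler01).
have C1 : 0 < C + 1 by rewrite ltr_wpDr// ltW.
exists (eta / (C + 1)), C; split; [by rewrite divr_gt0|by []|].
move=> x' tx' t0 t t0b tb small.
have [t00 t0b'] := andP t0b; have [t0' tb'] := andP tb.
have px := primitive_onB tx'.2 tx.2.
have CD : C * `|x' t0 - x t0| < eta.
  apply: (@le_lt_trans _ _ ((C + 1) * `|x' t0 - x t0|)).
    by rewrite ler_wpM2r// lerDl.
  by rewrite mulrC -ltr_pdivlMr.
have smaller : `|x' t0 - x t0| < eta.
  apply: lt_le_trans small _; rewrite ler_pdivrMr// ler_peMr ?(ltW eta0)//.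
  by rewrite lerDr ltW.
pose g t := `|x' t - x t|.
have cg : {within `[0, b], continuous g}.
  by have [c _] := px => y; apply: cvg_norm; exact: c.
(* Gronwall on any interval on which the difference stays in the tube. *)
have stay a c : 0 <= a -> c <= b ->
    (forall y, a < y < c -> `|x' y - x y| < eta) ->
    forall t1 t2, a <= t1 <= c -> a <= t2 <= c ->
      `|x' t2 - x t2| <= C * `|x' t1 - x t1|.
  move=> a0 cb ac t1 t2 t1ac t2ac.
  rewrite -[`|x' t1 - x t1|]addr0.
  apply: (gron s a c _ _ 0 a0 cb (lexx 0) (primitive_onW a0 cb px)) => //.
  move=> y yac; rewrite addr0.
  have yb : 0 <= y <= b.
    by case/andP: yac => h1 h2; rewrite (le_trans a0 (ltW h1)) (le_trans (ltW h2)).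
  have [_] := H _ _ (ac y yac) yb.
  rewrite [x y + _]addrC subrK mul1r => h.
  have -> : F (x' y) (v y) - F (x y) (v y) =
    (F (x' y) (v y) - F (x y) (v y) - (x' y - x y) *m D1 F (x y) (v y)) +
    (x' y - x y) *m D1 F (x y) (v y) by rewrite subrK.
  rewrite (le_trans (ler_normD _ _))// mulrDl mul1r addrC lerD//.
  rewrite (le_trans (mx_norm_mul _ _))// -mulrA ler_wpM2l// mulrC ler_wpM2r//.
  exact: HK.
have [tt0|/ltW t0t] := leP t0 t.
  have below y : t0 <= y <= t -> `|x' y - x y| < eta.
    move=> /andP[ty yt]; rewrite ltNge; apply/negP => bad.
    have yb := le_trans yt tb'.
    have [|z /andP[z1 z2] [gz Hz]] := @first_exit _ g _ _ _ ty _ smaller bad.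
      apply: continuous_subspaceW cg => z /=; rewrite !in_itv /= => /andP[h1 h2].
      by rewrite (le_trans t00)// (le_trans h2).
    have := stay t0 z t00 (le_trans z2 yb) _ t0 z _ _.
    move=> h; have : eta <= C * `|x' t0 - x t0|.
      apply: le_trans gz _; apply: h; rewrite ?lexx ?(ltW z1)//.
      by move=> w /andP[w1 w2]; apply: Hz; rewrite ltW.
    by rewrite leNgt CD.
  apply: (stay t0 t) => //; rewrite ?lexx ?tt0//.
  by move=> y /andP[h1 h2]; apply: below; rewrite !ltW.
have below y : t <= y <= t0 -> `|x' y - x y| < eta.
  move=> /andP[ty yt]; rewrite ltNge; apply/negP => bad.
  have y0 := le_trans t0' ty.
  have [|z /andP[z1 z2] [gz Hz]] := @last_entry _ g _ _ _ yt _ bad smaller.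
    apply: continuous_subspaceW cg => z /=; rewrite !in_itv /= => /andP[h1 h2].
    by rewrite (le_trans y0 h1) (le_trans h2).
  have := stay z t0 (le_trans y0 z1) t0b' _ t0 z _ _.
  move=> h; have : eta <= C * `|x' t0 - x t0|.
    apply: le_trans gz _; apply: h; rewrite ?lexx ?(ltW z2)//.
    by move=> w /andP[w1 w2]; apply: Hz; rewrite w1 ltW.
  by rewrite leNgt CD.
apply: (stay t t0) => //; rewrite ?lexx ?t0t//.
by move=> y /andP[h1 h2]; apply: below; rewrite !ltW.
Qed.

(** The case [t0 = 0] is uniqueness of solutions; the case of a later time [t0]
    gives injectivity of the flow. *)
Lemma trajectory_unique x x' t0 : trajectory x -> trajectory x' ->
  0 <= t0 <= b -> x' t0 = x t0 -> forall t, 0 <= t <= b -> x' t = x t.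
Proof.
move=> tx tx' t0b e t tb; have [eta [C [eta0 _ H]]] := flow_lipschitz tx.
have := H _ tx' _ _ t0b tb; rewrite e subrr normr0 mulr0 => /(_ eta0).
by rewrite normr_le0 subr_eq0 => /eqP.
Qed.

(** * The variational equation *)

Lemma trajectory_mx_continuous x (A : 'rV[R]_n -> 'rV[R]_m -> 'M[R]_n) t :
  trajectory x ->
  {within X `*` V, continuous (fun z : 'rV[R]_n * 'rV[R]_m => A z.1 z.2)} ->
  0 < t < b -> t \notin s -> {for t, continuous (fun t => A (x t) (v t))}.
Proof. by move=> [xX [cx _]] cA; apply: (trajectory_continuous openX regv cx xX cA). Qed.

Hypothesis extF : forall p, X p -> exists2 x, x 0 = p & trajectory x.

(** The solution of the variational equation with initial value [e] is the
    uniform limit of the difference quotients of trajectories in direction [e];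
    by Gronwall they form a Cauchy sequence. *)
Lemma variational_vector x (e : 'rV[R]_n) : trajectory x ->
  exists2 u : R -> 'rV[R]_n, u 0 = e &
    primitive_on s 0 b u (fun t => u t *m D1 F (x t) (v t)).
Proof.
move=> tx; have [dF cD] := C1F.
have [eta [C [eta0 C0 lip]]] := flow_lipschitz tx.
have [K K0 HK] := bounded tx cD.
have zb : (0 : R) <= 0 <= b by rewrite lexx.
have [sg sg0 sgX] := taylor1 tx ltr01.
have E0 : 0 < `|e| + 1 by rewrite ltr_wpDl.
pose ka := Num.min eta sg / (`|e| + 1) / 2.
have ka0 : 0 < ka by rewrite !divr_gt0// lt_min eta0.
(* the step sizes; [ka] keeps the perturbed initial values in the tube *)
pose ep (j : nat) : R := ka / j.+1%:R.
have ep0 j : 0 < ep j by rewrite divr_gt0.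
have epe j : `|ep j *: e| < Num.min eta sg.
  rewrite normrZ gtr0_norm//.
  have h1 : ep j <= ka by rewrite ler_pdivrMr// ler_peMr ?ler1n// ltW.
  have h2 : ka * (`|e| + 1) = Num.min eta sg / 2.
    by rewrite /ka; field; rewrite gt_eqF.
  have h3 : 0 < Num.min eta sg by rewrite lt_min eta0.
  have h4 := ep0 j; have h5 := normr_ge0 e.
  apply: (@le_lt_trans _ _ (ka * (`|e| + 1))); last by rewrite h2; lra.
  nra.
have epe1 j : `|ep j *: e| < eta by have := epe j; rewrite lt_min => /andP[].
have epe2 j : `|ep j *: e| < sg by have := epe j; rewrite lt_min => /andP[].
have /choice[y yP] j : exists y, y 0 = x 0 + ep j *: e /\ trajectory y.
  have [|y y0 ty] := extF (p := x 0 + ep j *: e); last by exists y.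
  by have [] := sgX (ep j *: e) 0 (epe2 j) zb.
pose d j t := (ep j)^-1 *: (y j t - x t).
have yx j t : 0 <= t <= b -> `|y j t - x t| <= C * (ep j * `|e|).
  move=> tb; have := lip _ (yP j).2 0 t zb tb.
  rewrite (yP j).1 [x 0 + _]addrC addrK epe1.
  by rewrite normrZ gtr0_norm// => /(_ isT).
have d0 j : d j 0 = e.
  by rewrite /d (yP j).1 [x 0 + _]addrC addrK scalerK// gt_eqF.
pose dd j t := (ep j)^-1 *: (F (y j t) (v t) - F (x t) (v t)).
have pd j : primitive_on s 0 b (d j) (dd j).
  by apply: primitive_onZ; apply: primitive_onB; [exact: (yP j).2.2|exact: tx.2].
have res (de : R) : 0 < de -> exists N, forall j t, (N <= j)%N -> 0 <= t <= b ->
    `|dd j t - d j t *m D1 F (x t) (v t)| <= de.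
  move=> de0; have CE0 : 0 < C * `|e| + 1 by rewrite ltr_wpDl// mulr_ge0// ltW.
  have [rho rho0 H] := taylor1 tx (divr_gt0 de0 CE0).
  exists (Num.truncn (ka * (C * `|e| + 1) / rho)).+1 => j t Nj tb.
  have small : `|y j t - x t| < rho.
    apply: (le_lt_trans (yx j t tb)).
    have h1 : ka * (C * `|e| + 1) / rho < j.+1%:R.
      apply: lt_le_trans (truncnS_gt _) _; rewrite ler_nat.
      exact: leq_trans Nj _.
    rewrite ltr_pdivrMr// in h1.
    rewrite /ep; apply: (@le_lt_trans _ _ (ka * (C * `|e| + 1) / j.+1%:R)).
      have -> : C * (ka / j.+1%:R * `|e|) = ka / j.+1%:R * (C * `|e|) by ring.
      rewrite [leRHS]mulrAC ler_wpM2l ?lerDl//; exact: ltW (ep0 j).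
    by rewrite ltr_pdivrMr// [rho * _]mulrC.
  have [_] := H _ _ small tb.
  rewrite [x t + _]addrC subrK => h.
  have -> : dd j t - d j t *m D1 F (x t) (v t) = (ep j)^-1 *:
     (F (y j t) (v t) - F (x t) (v t) - (y j t - x t) *m D1 F (x t) (v t)).
    by rewrite /dd /d -scalemxAl -scalerBr.
  rewrite normrZ normfV gtr0_norm// ler_pdivrMl//.
  apply: (le_trans h); rewrite mulrAC ler_pdivrMr//.
  have h1 := ler_wpM2l (ltW de0) (yx j t tb); have h2 := mulr_gt0 de0 (ep0 j).
  lra.
have [Cg Cg0 gron] := gronwall n b (mulr_ge0 (ler0n R n) K0).
have uA (A : R -> 'rV[R]_n) t : 0 <= t <= b ->
    `|A t *m D1 F (x t) (v t)| <= n%:R * K * `|A t|.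
  move=> tb; rewrite (le_trans (mx_norm_mul _ _))// -mulrA ler_wpM2l//.
  by rewrite mulrC ler_wpM2r// HK.
have cauchy_d (de : R) : 0 < de -> exists N, forall i j t,
    (N <= i)%N -> (N <= j)%N -> 0 <= t <= b -> `|d i t - d j t| <= de.
  move=> de0; have de1 : 0 < de / Cg / 2 by rewrite !divr_gt0.
  have [N HN] := res _ de1; exists N => i j t Ni Nj tb.
  have := gron s 0 b _ _ (de / Cg) (lexx 0) (lexx b) (ltW (divr_gt0 de0 Cg0))
    (primitive_onB (pd i) (pd j)) _ 0 t zb tb.
  rewrite !d0 subrr normr0 add0r [Cg * _]mulrC divfK ?gt_eqF//; apply.
  move=> z /andP[z0 zb']; have zI : 0 <= z <= b by rewrite !ltW.
  have -> : dd i z - dd j z = (d i z - d j z) *m D1 F (x z) (v z) +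
     ((dd i z - d i z *m D1 F (x z) (v z)) - (dd j z - d j z *m D1 F (x z) (v z))).
    by rewrite mulmxBl; apply/matrixP => k l; rewrite !mxE; ring.
  rewrite (le_trans (ler_normD _ _))// lerD//.
    exact: (uA (fun z => d i z - d j z)).
  rewrite (splitr (de / Cg)) (le_trans (ler_normB _ _))// lerD//; exact: HN.
pose u t := lim (d j t @[j --> \oo]).
have cvu t : 0 <= t <= b -> d j t @[j --> \oo] --> u t.
  move=> tb; apply/cauchy_cvgP/cauchy_exP => de de0.
  have de2 : 0 < de / 2 by rewrite divr_gt0.
  have [N HN] := cauchy_d _ de2; exists (d N t); exists N => // j /= Nj.
  rewrite -ball_normE /=; apply: (le_lt_trans (HN N j t _ _ tb)) => //.
  by rewrite ltr_pdivrMr// ltr_pMr// ltr1n.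
have lim_u (de : R) : 0 < de -> exists N, forall j t, (N <= j)%N -> 0 <= t <= b ->
    `|d j t - u t| <= de.
  move=> de0; have de2 : 0 < de / 2 by rewrite divr_gt0.
  have [N HN] := cauchy_d _ de2; exists N => j t Nj tb.
  have := cvu t tb => /cvgrPdist_le/(_ _ de2)[M _ HM].
  have h1 := HN j (maxn N M) t Nj (leq_maxl _ _) tb.
  have h2 := HM (maxn N M) (leq_maxr _ _).
  have -> : d j t - u t = (d j t - d (maxn N M) t) - (u t - d (maxn N M) t).
    by apply/matrixP => k l; rewrite !mxE; ring.
  by rewrite (splitr de) (le_trans (ler_normB _ _))// lerD.
have u0 : u 0 = e.
  apply/cvg_lim => //; rewrite (_ : (fun j => _) = fun=> e); first exact: cvg_cst.
  by apply/funext => j; exact: d0.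
have lim2 (de : R) : 0 < de -> exists j, forall t, 0 <= t <= b ->
    `|d j t - u t| <= de /\ `|dd j t - u t *m D1 F (x t) (v t)| <= de.
  move=> de0; have de2 : 0 < de / 2 by rewrite divr_gt0.
  have nK : 0 < n%:R * K + 1 by rewrite ltr_wpDl// mulr_ge0.
  have [N HN] := res _ de2.
  have h0 : 0 < Num.min de (de / 2 / (n%:R * K + 1)) by rewrite lt_min de0 !divr_gt0.
  have [M HM] := lim_u _ h0.
  exists (maxn N M) => t tb.
  have := HM _ _ (leq_maxr N M) tb; rewrite le_min => /andP[h1 h2]; split=> //.
  have h3 := HN _ _ (leq_maxl N M) tb.
  have -> : dd (maxn N M) t - u t *m D1 F (x t) (v t) =
     (dd (maxn N M) t - d (maxn N M) t *m D1 F (x t) (v t)) +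
     (d (maxn N M) t - u t) *m D1 F (x t) (v t).
    by rewrite mulmxBl; apply/matrixP => k l; rewrite !mxE; ring.
  rewrite (splitr de) (le_trans (ler_normD _ _))// lerD//.
  rewrite (le_trans (uA (fun t => d (maxn N M) t - u t) t tb))//.
  rewrite ler_pdivlMr// in h2; have := normr_ge0 (d (maxn N M) t - u t); nra.
have [cu pu] := primitive_on_limit pd lim2.
exists u => //; apply: pu => t tb ts.
apply: cvg_mulmx.
  exact: within_itv_continuous cu tb.
exact: trajectory_mx_continuous.
Qed.

Lemma variational_matrix x : trajectory x ->
  exists2 M : R -> 'M[R]_n, M 0 = 1%:M &
    primitive_on s 0 b M (fun t => M t *m D1 F (x t) (v t)).
Proof.
move=> tx.
have /choice[u uP] i : exists u : R -> 'rV[R]_n, u 0 = delta_mx 0 i /\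
    primitive_on s 0 b u (fun t => u t *m D1 F (x t) (v t)).
  by have [u u0 pu] := variational_vector (delta_mx 0 i) tx; exists u.
exists (fun t => \matrix_(i, j) u i t ord0 j).
  by apply/matrixP => i j; rewrite !mxE (uP i).1 mxE eqxx eq_sym.
apply/primitive_on_mxP => i j.
have -> : (fun t => (\matrix_(i, j) u i t ord0 j) i j) = fun t => u i t ord0 j.
  by apply/funext => t; rewrite mxE.
have /primitive_on_mxP/(_ ord0 j) := (uP i).2.
apply: eq_primitive_on => t _; rewrite !mxE; apply: eq_bigr => k _.
by congr (_ * _); rewrite mxE.
Qed.

(** A solution [h *m M] of the variational equation that vanishes at one time
    vanishes at time 0, by Gronwall backwards in time. *)
Lemma variational_unit x M : trajectory x -> M 0 = 1%:M ->
  primitive_on s 0 b M (fun t => M t *m D1 F (x t) (v t)) ->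
  forall t, 0 <= t <= b -> M t \in unitmx.
Proof.
move=> tx M0 pM t tb; have [dF cD] := C1F.
have [K K0 HK] := bounded tx cD.
have [Cg Cg0 gron] := gronwall n b (mulr_ge0 (ler0n R n) K0).
rewrite -row_free_unit -kermx_eq0; apply/eqP/row_matrixP => i.
set h := row i _; rewrite row0.
have hM : h *m M t = 0.
  by apply/sub_kermxP; exact: row_sub.
have ph : primitive_on s 0 b (fun t => h *m M t)
    (fun t => (h *m M t) *m D1 F (x t) (v t)).
  have := primitive_on_mulmx (primitive_on_cst s 0 b h) pM.
  by apply: eq_primitive_on => y _; rewrite mul0mx add0r mulmxA.
have := gron s 0 b _ _ 0 (lexx 0) (lexx b) (lexx 0) ph _ t 0 tb _.
rewrite M0 mulmx1 hM normr0 addr0 mulr0 lexx b0 => H.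
apply/eqP; rewrite -normr_le0; apply: H => // y /andP[y0 yb].
rewrite addr0 (le_trans (mx_norm_mul _ _))// -mulrA ler_wpM2l//.
by rewrite mulrC ler_wpM2r// HK// !ltW.
Qed.

(** * Expansions of the flow in the initial value *)

(** The error [x' - x - h *m M] vanishes at time 0 and solves the variational
    equation up to the remainder of the Taylor formula of [F], which is [o(|h|)]
    because [|x' - x| <= C * |h|]. *)
Lemma flow_first_order x M (eps : R) : trajectory x -> M 0 = 1%:M ->
  primitive_on s 0 b M (fun t => M t *m D1 F (x t) (v t)) -> 0 < eps ->
  exists2 eta : R, 0 < eta & forall x', trajectory x' ->
    `|x' 0 - x 0| < eta -> forall t, 0 <= t <= b ->
    `|x' t - x t - (x' 0 - x 0) *m M t| <= eps * `|x' 0 - x 0|.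
Proof.
move=> tx M0 pM eps0; have [dF cD] := C1F.
have [K K0 HK] := bounded tx cD.
have [eta [C [eta0 C0 lip]]] := flow_lipschitz tx.
have [Cg Cg0 gron] := gronwall n b (mulr_ge0 (ler0n R n) K0).
have e0 : 0 < eps / (Cg * C) by rewrite divr_gt0// mulr_gt0.
have [rho rho0 H] := taylor1 tx e0.
have zb : (0 : R) <= 0 <= b by rewrite lexx.
exists (Num.min eta (rho / C)); first by rewrite lt_min eta0 divr_gt0.
move=> x' tx'; rewrite lt_min => /andP[h1 h2] t tb.
set h := x' 0 - x 0 in h1 h2 *.
have xx y : 0 <= y <= b -> `|x' y - x y| <= C * `|h|.
  by move=> yb; exact: (lip _ tx' 0 y zb yb h1).
have ph := primitive_on_mulmx (primitive_on_cst s 0 b h) pM.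
have pz := primitive_onB (primitive_onB tx'.2 tx.2) ph.
have := gron s 0 b _ _ (eps / (Cg * C) * (C * `|h|)) (lexx 0) (lexx b) _ pz _ 0 t zb tb.
rewrite M0 mulmx1 subrr normr0 add0r.
have -> : Cg * (eps / (Cg * C) * (C * `|h|)) = eps * `|h|.
  by field; rewrite !gt_eqF.
apply; first by apply: mulr_ge0; [exact: ltW e0|rewrite mulr_ge0// ltW].
move=> y /andP[y0 yb']; have yb : 0 <= y <= b by rewrite !ltW.
have small : `|x' y - x y| < rho.
  by apply: (le_lt_trans (xx y yb)); rewrite mulrC -ltr_pdivlMr.
have [_] := H _ _ small yb; rewrite [x y + _]addrC subrK => h3.
have -> : F (x' y) (v y) - F (x y) (v y) -
    (0 *m M y + h *m (M y *m D1 F (x y) (v y))) =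
  (x' y - x y - h *m M y) *m D1 F (x y) (v y) +
  (F (x' y) (v y) - F (x y) (v y) - (x' y - x y) *m D1 F (x y) (v y)).
  rewrite mul0mx add0r mulmxA [(_ - h *m M y) *m _]mulmxBl.
  by apply/matrixP => i j; rewrite !mxE; ring.
rewrite (le_trans (ler_normD _ _))// lerD//.
  rewrite (le_trans (mx_norm_mul _ _))// -mulrA ler_wpM2l//.
  by rewrite mulrC ler_wpM2r// HK.
by rewrite (le_trans h3)// ler_wpM2l ?xx// ltW.
Qed.

Hypothesis C2F : C2_fst X V F.

Lemma D11_sum y w (h : 'rV[R]_n) :
  D11 F y w h = \sum_i h ord0 i *: D11 F y w (delta_mx ord0 i).
Proof.
rewrite [in LHS](row_sum_delta h) /D11 linear_sum.
by apply: eq_bigr => i _; rewrite linearZ.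
Qed.

Let coord_bound (A : 'rV[R]_n -> 'M[R]_n) (e : R) h : 0 <= e ->
  (forall h, A h = \sum_i h ord0 i *: A (delta_mx ord0 i)) ->
  (forall i, `|A (delta_mx ord0 i)| <= e) -> `|A h| <= n%:R * e * `|h|.
Proof.
move=> e0 Alin Ae; rewrite Alin (le_trans (ler_norm_sum _ _ _))//.
have -> : n%:R * e * `|h| = \sum_(i < n) (e * `|h|).
  by rewrite sumr_const card_ord -[RHS]mulr_natl mulrA.
apply: ler_sum => i _; rewrite normrZ mulrC ler_pM//.
exact: mx_norm_coord.
Qed.

(** Uniformity in [h] comes from linearity: a basis, hence finitely many
    directions, suffices. *)
Lemma D11_tube x (eps : R) : trajectory x -> 0 < eps ->
  exists2 eta : R, 0 < eta & forall d t h, `|d| < eta -> 0 <= t <= b ->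
    X (x t + d) /\
    `|D11 F (x t + d) (v t) h - D11 F (x t) (v t) h| <= eps * `|h|.
Proof.
move=> tx eps0; have [_ _ cD] := C2F.
have e0 : 0 < eps / (n%:R + 1) by rewrite divr_gt0.
have : \forall d \near (0 : 'rV[R]_n), forall i : 'I_n, forall t, 0 <= t <= b ->
    `|D11 F (x t + d) (v t) (delta_mx ord0 i) -
      D11 F (x t) (v t) (delta_mx ord0 i)| <= eps / (n%:R + 1).
  have Hi i : \forall d \near (0 : 'rV[R]_n), forall t, 0 <= t <= b ->
      `|D11 F (x t + d) (v t) (delta_mx ord0 i) -
        D11 F (x t) (v t) (delta_mx ord0 i)| <= eps / (n%:R + 1); last first.
    exact: (filter_forall _ Hi).
  have [eta eta0 H] := @tube _ (fun y w => D11 F y w (delta_mx ord0 i))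
    x tx (cD (delta_mx ord0 i)) _ e0.
  by apply/nbhs_norm0P; exists eta => // d de t tb; have [] := H d t de tb.
move=> /nbhs_norm0P[eta /= eta0 H].
have [sg sg0 sgX] := taylor1 tx ltr01.
exists (Num.min eta sg); first by rewrite lt_min eta0.
move=> d t h; rewrite lt_min => /andP[de ds] tb.
split; first by have [] := sgX d t ds tb.
apply: (@le_trans _ _ (n%:R * (eps / (n%:R + 1)) * `|h|)).
  apply: (@coord_bound (fun h => D11 F (x t + d) (v t) h - D11 F (x t) (v t) h)).
  - exact: ltW.
  - move=> k; rewrite D11_sum [D11 F (x t) _ _]D11_sum -sumrB.
    by apply: eq_bigr => i _; rewrite scalerBr.
  - by move=> i; exact: H.
by rewrite ler_wpM2r// n1_le// ltW.
Qed.

Lemma D11_bounded x : trajectory x -> exists2 B : R, 0 <= B &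
  forall t h, 0 <= t <= b -> `|D11 F (x t) (v t) h| <= B * `|h|.
Proof.
move=> tx; have [_ _ cD] := C2F.
have /choice[Bi HB] i : exists B : R, 0 <= B /\ forall t, 0 <= t <= b ->
    `|D11 F (x t) (v t) (delta_mx ord0 i)| <= B.
  have [B B0 H] := @bounded _ (fun y w => D11 F y w (delta_mx ord0 i))
    x tx (cD (delta_mx ord0 i)).
  by exists B.
have S0 : 0 <= \sum_i Bi i by apply: sumr_ge0 => i _; exact: (HB i).1.
exists (n%:R * \sum_i Bi i); first by rewrite mulr_ge0.
move=> t h tb; apply: coord_bound => //; first by move=> k; exact: D11_sum.
move=> i; apply: (le_trans ((HB i).2 t tb)); rewrite (bigD1 i)//= lerDl.
by apply: sumr_ge0 => j _; exact: (HB j).1.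
Qed.

(** The Taylor formula for [F] follows from the mean value inequality applied
    twice, first to [D1 F] and then to [F] minus its Taylor polynomial along the
    segment from [x t] to [x t + d]. *)
Lemma taylor2 x (eps : R) : trajectory x -> 0 < eps ->
  exists2 eta : R, 0 < eta & forall d t, `|d| < eta -> 0 <= t <= b ->
    `|F (x t + d) (v t) - F (x t) (v t) - d *m D1 F (x t) (v t) -
      2^-1 *: (d *m D11 F (x t) (v t) d)| <= eps * `|d| ^+ 2.
Proof.
move=> tx eps0; have [[dF _] dD _] := C2F; have [vV _ _ _] := regv.
have e0 : 0 < eps / (n%:R + 1) by rewrite divr_gt0.
have [eta eta0 H] := D11_tube tx e0.
exists eta => // d t de tb.
have kde k : 0 <= k <= 1 -> `|k *: d| < eta.
  by move=> k01; apply: le_lt_trans de; exact: norm_kd.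
have inner k : 0 <= k <= 1 ->
    `|D1 F (x t + k *: d) (v t) - D1 F (x t) (v t) - k *: D11 F (x t) (v t) d|
      <= eps / (n%:R + 1) * `|d|.
  move=> k01.
  have -> : k *: D11 F (x t) (v t) d = D11 F (x t) (v t) (k *: d).
    by rewrite /D11 linearZ.
  have kl l : 0 <= l <= 1 -> `|l *: (k *: d)| < eta.
    by move=> l01; apply: le_lt_trans (kde k k01); exact: norm_kd.
  apply: (@mean_value_segment _ _ _ _ (fun y => D1 F y (v t))) => l l01.
    by apply: dD; [have [] := H _ t 0 (kl l l01) tb|exact: vV].
  have [_ h1] := H _ t (k *: d) (kl l l01) tb.
  by rewrite (le_trans h1)// ler_wpM2l ?norm_kd// ltW.
have p1 : primitive_on [::] 0 1 (fun k => F (x t + k *: d) (v t))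
    (fun k => d *m D1 F (x t + k *: d) (v t)).
  have := @primitive_on_line _ _ _ _ (F ^~ (v t)) (x t) d.
  move=> H1; apply: (eq_primitive_on _ (H1 _)) => k k01.
    by rewrite diff_fst.
  by apply: dF; [have [] := H _ t 0 (kde k k01) tb|exact: vV].
have p2 := primitive_on_scale (d *m D1 F (x t) (v t)) (primitive_on_id [::] 0 1).
have p3 := primitive_on_scale (2^-1 *: (d *m D11 F (x t) (v t) d))
  (primitive_onM (primitive_on_id [::] 0 1) (primitive_on_id [::] 0 1)).
have := primitive_on_lipschitz ler01 (primitive_onB (primitive_onB p1 p2) p3).
move=> /(_ (eps * `|d| ^+ 2)) H1.
have -> : eps * `|d| ^+ 2 = eps * `|d| ^+ 2 * (1 - 0) by rewrite subr0 mulr1.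
have -> : F (x t + d) (v t) - F (x t) (v t) - d *m D1 F (x t) (v t) -
      2^-1 *: (d *m D11 F (x t) (v t) d) =
   F (x t + 1 *: d) (v t) - 1 *: (d *m D1 F (x t) (v t)) -
      (1 * 1) *: (2^-1 *: (d *m D11 F (x t) (v t) d)) -
   (F (x t + 0 *: d) (v t) - 0 *: (d *m D1 F (x t) (v t)) -
      (0 * 0) *: (2^-1 *: (d *m D11 F (x t) (v t) d))).
  rewrite mul0r mul1r !scale0r !scale1r !subr0 addr0.
  by apply/matrixP => i j; rewrite !mxE; ring.
apply: H1 => k /andP[k0 k1]; have k01 : 0 <= k <= 1 by rewrite !ltW.
have -> : d *m D1 F (x t + k *: d) (v t) - 1 *: (d *m D1 F (x t) (v t)) -
   (1 * k + k * 1) *: (2^-1 *: (d *m D11 F (x t) (v t) d)) =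
   d *m (D1 F (x t + k *: d) (v t) - D1 F (x t) (v t) - k *: D11 F (x t) (v t) d).
  rewrite !mulmxBr scale1r scalerA -scalemxAr; congr (_ - _ *: _).
  by rewrite mul1r mulr1; field.
rewrite (le_trans (mx_norm_mul _ _))//.
have h1 := inner k k01.
apply: (@le_trans _ _ (n%:R * (`|d| * (eps / (n%:R + 1) * `|d|)))).
  by rewrite !ler_wpM2l.
have -> : n%:R * (`|d| * (eps / (n%:R + 1) * `|d|)) =
  n%:R * (eps / (n%:R + 1)) * `|d| ^+ 2 by ring.
by rewrite ler_wpM2r ?sqr_ge0// n1_le// ltW.
Qed.

(** With [h = x' 0 - x 0] and [k = h *m M], the curve [(h + Q / 2) *m M] solves
    the variational equation with the additional forcing term
    [D_1^2 F (k, k) / 2]; this is, up to [o(|h|^2)], also the equation of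
    [x' - x], and Gronwall compares the two. *)
Lemma flow_second_order x M (eps : R) : trajectory x -> M 0 = 1%:M ->
  primitive_on s 0 b M (fun t => M t *m D1 F (x t) (v t)) -> 0 < eps ->
  exists2 eta : R, 0 < eta & forall x' Q, trajectory x' ->
    let h := x' 0 - x 0 in `|h| < eta -> Q 0 = 0 ->
    primitive_on s 0 b Q (fun t => (h *m M t) *m
      D11 F (x t) (v t) (h *m M t) *m invmx (M t)) ->
    forall t, 0 <= t <= b ->
    `|x' t - x t - (h + 2^-1 *: Q t) *m M t| <= eps * `|h| ^+ 2.
Proof.
move=> tx M0 pM eps0; have [dF cD] := C1F.
have Mu := variational_unit tx M0 pM.
have [K K0 HK] := bounded tx cD.
have [B B0 HB] := D11_bounded tx.
have [eta [C [eta0 C0 lip]]] := flow_lipschitz tx.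
have [Cg Cg0 gron] := gronwall n b (mulr_ge0 (ler0n R n) K0).
have N0 : 0 <= n%:R * B by rewrite mulr_ge0.
pose e1 := eps / Cg / 2 / C ^+ 2.
have e10 : 0 < e1 by rewrite !divr_gt0// exprn_gt0.
pose e2 := Num.min 1 (eps / Cg / 2 / ((n%:R * B + 1) * (2 * C + 1))).
have D0 : 0 < (n%:R * B + 1) * (2 * C + 1) by nra.
have e20 : 0 < e2 by rewrite lt_min ltr01 !divr_gt0.
have [rho rho0 H] := taylor2 tx e10.
have [sg sg0 H1] := flow_first_order tx M0 pM e20.
have zb : (0 : R) <= 0 <= b by rewrite lexx.
exists (Num.min (Num.min eta sg) (rho / C)).
  by rewrite !lt_min eta0 sg0 divr_gt0.
move=> x' Q tx' h; rewrite !lt_min => /andP[/andP[h1 h2] h3] Q0 pQ t tb.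
have xx y : 0 <= y <= b -> `|x' y - x y| <= C * `|h|.
  by move=> yb; exact: (lip _ tx' 0 y zb yb h1).
have ph : primitive_on s 0 b (fun y => (h + 2^-1 *: Q y)) _ :=
  primitive_onD (primitive_on_cst s 0 b h) (primitive_onZ 2^-1 pQ).
have pz := primitive_onB (primitive_onB tx'.2 tx.2) (primitive_on_mulmx ph pM).
have := gron s 0 b _ _ (eps / Cg * `|h| ^+ 2) (lexx 0) (lexx b) _ pz _ 0 t zb tb.
rewrite M0 Q0 scaler0 addr0 mulmx1 subrr normr0 add0r.
have -> : Cg * (eps / Cg * `|h| ^+ 2) = eps * `|h| ^+ 2.
  by field; rewrite !gt_eqF.
apply; first by apply: mulr_ge0; [rewrite ltW// divr_gt0|exact: sqr_ge0].
move=> y /andP[y0 yb']; have yb : 0 <= y <= b by rewrite !ltW.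
have small : `|x' y - x y| < rho.
  by apply: (le_lt_trans (xx y yb)); rewrite mulrC -ltr_pdivlMr.
have := H _ _ small yb; rewrite [x y + _]addrC subrK => g1.
have g2 := H1 _ tx' h2 y yb; rewrite -/h in g2.
have uM : M y \in unitmx by exact: Mu.
pose dl := x' y - x y; pose k := h *m M y; pose D := D11 F (x y) (v y).
pose A := D1 F (x y) (v y).
have Dk : D (dl - k) = D dl - D k by rewrite /D /D11 linearB.
have -> : F (x' y) (v y) - F (x y) (v y) -
    ((0 + 2^-1 *: (h *m M y *m D11 F (x y) (v y) (h *m M y) *m invmx (M y))) *m M y +
     (h + 2^-1 *: Q y) *m (M y *m D1 F (x y) (v y))) =
  (x' y - x y - (h + 2^-1 *: Q y) *m M y) *m D1 F (x y) (v y) +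
  ((F (x' y) (v y) - F (x y) (v y) - dl *m A - 2^-1 *: (dl *m D dl)) +
   2^-1 *: ((dl - k) *m D dl + k *m D (dl - k))).
  rewrite add0r -scalemxAl mulmxKV// -/k -/(D k) -/A -/dl.
  rewrite mulmxA [(dl - _) *m A]mulmxBl Dk [(dl - k) *m _]mulmxBl [k *m (_ - _)]mulmxBr.
  by apply/matrixP => i j; rewrite !mxE; ring.
rewrite (le_trans (ler_normD _ _))// lerD//.
  rewrite (le_trans (mx_norm_mul _ _))// -mulrA ler_wpM2l//.
  by rewrite mulrC ler_wpM2r// HK.
rewrite (le_trans (ler_normD _ _))//.
have hn := normr_ge0 h.
have -> : eps / Cg * `|h| ^+ 2 = eps / Cg / 2 * `|h| ^+ 2 + eps / Cg / 2 * `|h| ^+ 2.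
  by rewrite -mulrDl -splitr.
have dlC : `|dl| <= C * `|h| := xx y yb.
apply: lerD.
  apply: (le_trans g1).
  apply: (@le_trans _ _ (e1 * (C * `|h|) ^+ 2)).
    rewrite ler_wpM2l ?(ltW e10)// lerXn2r ?nnegrE//.
    by rewrite mulr_ge0// ltW.
  rewrite /e1 exprMn mulrA divfK// gt_eqF// exprn_gt0//.
have e21 : e2 <= 1 by rewrite /e2 ge_min lexx.
have e2b : e2 * ((n%:R * B + 1) * (2 * C + 1)) <= eps / Cg / 2.
  by rewrite -ler_pdivlMr// /e2 ge_min lexx orbT.
have g3 : `|dl - k| <= e2 * `|h| := g2.
have kC : `|k| <= (C + 1) * `|h|.
  have -> : k = dl - (dl - k) by rewrite opprB addrC subrK.
  rewrite (le_trans (ler_normB _ _))// mulrDl lerD// (le_trans g3)//.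
  by rewrite ler_wpM2r.
have t1 : `|(dl - k) *m D dl| <= n%:R * ((e2 * `|h|) * (B * (C * `|h|))).
  rewrite (le_trans (mx_norm_mul _ _))// ler_wpM2l// ler_pM//.
  by rewrite (le_trans (HB _ _ yb))// ler_wpM2l.
have t2 : `|k *m D (dl - k)| <= n%:R * (((C + 1) * `|h|) * (B * (e2 * `|h|))).
  rewrite (le_trans (mx_norm_mul _ _))// ler_wpM2l// ler_pM//.
  by rewrite (le_trans (HB _ _ yb))// ler_wpM2l.
rewrite normrZ ger0_norm ?invr_ge0//.
apply: (@le_trans _ _ (`|(dl - k) *m D dl + k *m D (dl - k)|)).
  by rewrite ler_piMl// invf_le1// ler1n.
rewrite (le_trans (ler_normD _ _))//.
apply: (@le_trans _ _ (n%:R * B * (2 * C + 1) * e2 * `|h| ^+ 2)).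
  apply: (le_trans (lerD t1 t2)); rewrite le_eqVlt; apply/orP; left; apply/eqP; ring.
apply: ler_wpM2r; first exact: sqr_ge0.
apply: le_trans e2b; rewrite mulrC ler_wpM2l ?(ltW e20)//.
by rewrite ler_wpM2r ?lerDl//; lra.
Qed.

Lemma quadratic_term_primitive x M (h : 'rV[R]_n) : trajectory x ->
  M 0 = 1%:M -> primitive_on s 0 b M (fun t => M t *m D1 F (x t) (v t)) ->
  let g t := (h *m M t) *m D11 F (x t) (v t) (h *m M t) *m invmx (M t) in
  primitive_on s 0 b (fun t => vintegral 0 t g) g.
Proof.
move=> tx M0 pM g; have uM := variational_unit tx M0 pM.
have [_ _ cD] := C2F; have [cM _] := pM.
have [B B0 HB] := D11_bounded tx.
have cI : {within `[0, b], continuous (fun t => invmx (M t))}.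
  apply/subspace_continuousP => t tb; apply: cvg_invmx.
  - have : \forall y \near within `[0, b] (nbhs t), `[0, b]%classic y by exact: withinT.
    by apply: filterS => y; rewrite /= in_itv; exact: uM.
  - by apply: uM; move: tb; rewrite /= in_itv.
  - by move/subspace_continuousP : cM; exact.
have [BM HBM] := within_itv_bounded b0 cM.
have [BI HBI] := within_itv_bounded b0 cI.
have kB t : 0 <= t <= b -> `|h *m M t| <= n%:R * (`|h| * BM).
  by move=> tb; rewrite (le_trans (mx_norm_mul _ _))// !ler_wpM2l// HBM.
pose K := n%:R * (`|h| * BM).
apply: (@primitive_on_vintegral _ _ _ _ (n%:R * (n%:R * (K * (B * K)) * BI))).
  move=> t tb ts; have tb' : 0 <= t <= b by case/andP: tb => *; rewrite !ltW.
  have ck : h *m M y @[y --> t] --> h *m M t.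
    by apply: cvg_mulmx; [exact: cvg_cst|exact: within_itv_continuous cM tb].
  apply: cvg_mulmx; last exact: within_itv_continuous cI tb.
  apply: cvg_mulmx => //.
  rewrite D11_sum; under eq_fun do rewrite D11_sum.
  apply: cvg_big => [|i _]; first exact: add_continuous.
  apply: cvgZ; first by move/cvg_mxP : ck; exact.
  exact: (@trajectory_mx_continuous x (fun y w => D11 F y w (delta_mx ord0 i))).
move=> t tb; rewrite /g.
rewrite (le_trans (mx_norm_mul _ _))// ler_wpM2l//.
apply: ler_pM => //; last exact: HBI.
rewrite (le_trans (mx_norm_mul _ _))// ler_wpM2l//.
apply: ler_pM => //; first exact: kB.
by rewrite (le_trans (HB _ _ tb))// ler_wpM2l// kB.
Qed.

End Flow.
(** * The Euclidean norm *)

Section Euclidean.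
Context {R : realType} {n : nat}.
Implicit Types (x y : 'rV[R]_n) (k : R).

Definition dotp x y : R := \sum_i x ord0 i * y ord0 i.

Lemma dotpD x y z : dotp x (y + z) = dotp x y + dotp x z.
Proof.
by rewrite /dotp -big_split; apply: eq_bigr => i _; rewrite mxE mulrDr.
Qed.

Lemma dotpZ k x y : dotp x (k *: y) = k * dotp x y.
Proof.
by rewrite /dotp mulr_sumr; apply: eq_bigr => i _; rewrite mxE; ring.
Qed.

Lemma sqr_enorm x : enorm x ^+ 2 = \sum_i x ord0 i ^+ 2.
Proof. by rewrite sqr_sqrtr//; apply: sumr_ge0 => i _; exact: sqr_ge0. Qed.

Lemma enorm_ge0 x : 0 <= enorm x.
Proof. exact: sqrtr_ge0. Qed.

Lemma sqr_enormD x y :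
  enorm (x + y) ^+ 2 = enorm x ^+ 2 + 2 * dotp x y + enorm y ^+ 2.
Proof.
rewrite !sqr_enorm /dotp mulr_sumr -!big_split; apply: eq_bigr => i _ /=.
by rewrite mxE; ring.
Qed.

Lemma enormZ k x : enorm (k *: x) = `|k| * enorm x.
Proof.
rewrite /enorm -[in RHS]sqrtr_sqr -sqrtrM ?sqr_ge0// mulr_sumr.
by congr Num.sqrt; apply: eq_bigr => i _; rewrite mxE exprMn.
Qed.

Lemma enormN x : enorm (- x) = enorm x.
Proof. by rewrite -scaleN1r enormZ normrN1 mul1r. Qed.

Lemma norm_le_enorm x : `|x| <= enorm x.
Proof.
have /andP[h _] := sqr_norm_coords x.
by rewrite -(@ler_pXn2r _ 2%N) ?nnegrE// ?enorm_ge0// sqr_enorm.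
Qed.

Lemma enorm_le_norm x : enorm x <= (n%:R + 1) * `|x|.
Proof.
have /andP[_ h] := sqr_norm_coords x.
have n0 : 0 <= n%:R :> R by [].
rewrite -(@ler_pXn2r _ 2%N) ?nnegrE// ?enorm_ge0 ?mulr_ge0 ?addr_ge0//.
rewrite sqr_enorm (le_trans h)// exprMn ler_wpM2r ?sqr_ge0//; nra.
Qed.

Lemma enorm_eq0 x : enorm x = 0 -> x = 0.
Proof.
move=> x0; apply/eqP; rewrite -normr_le0; rewrite -x0; exact: norm_le_enorm.
Qed.

Lemma cauchy_schwarz x y : dotp x y <= enorm x * enorm y.
Proof.
have [->|x0] := eqVneq x 0.
  rewrite /dotp big1 ?mulr_ge0 ?enorm_ge0// => i _.
  by rewrite mxE mul0r.
have [->|y0] := eqVneq y 0.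
  rewrite /dotp big1 ?mulr_ge0 ?enorm_ge0// => i _.
  by rewrite mxE mulr0.
have a0 : 0 < enorm x.
  by rewrite lt_neqAle enorm_ge0 andbT eq_sym; apply: contra_neq x0; exact: enorm_eq0.
have b0 : 0 < enorm y.
  by rewrite lt_neqAle enorm_ge0 andbT eq_sym; apply: contra_neq y0; exact: enorm_eq0.
have := sqr_ge0 (enorm (enorm y *: x + (- enorm x) *: y)).
rewrite sqr_enormD !enormZ dotpZ normrN !ger0_norm ?enorm_ge0//.
have -> : dotp (enorm y *: x) y = enorm y * dotp x y.
  by rewrite /dotp mulr_sumr; apply: eq_bigr => i _; rewrite mxE; ring.
have ab0 := mulr_gt0 a0 b0.
move=> h; rewrite -(ler_pM2l ab0); lra.
Qed.

Lemma enormD x y : enorm (x + y) <= enorm x + enorm y.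
Proof.
rewrite -(@ler_pXn2r _ 2%N) ?nnegrE ?addr_ge0 ?enorm_ge0//.
rewrite sqr_enormD; have := cauchy_schwarz x y; nra.
Qed.

Lemma cvg_enorm (T : Type) (F : set_system T) (FF : Filter F)
    (f : T -> 'rV[R]_n) (l : 'rV[R]_n) :
  f x @[x --> F] --> l -> enorm (f x) @[x --> F] --> enorm l.
Proof.
move=> fl; apply/cvgrPdist_le => e e0.
have n1 : 0 < n%:R + 1 :> R by rewrite ltr_wpDl.
have e1 : 0 < e / (n%:R + 1) by rewrite divr_gt0.
have /cvgrPdist_le/(_ _ e1) := fl; apply: filterS => t ht.
have key : enorm (l - f t) <= e.
  apply: (le_trans (enorm_le_norm _)).
  by rewrite mulrC -ler_pdivlMr.
rewrite ler_norml; apply/andP; split.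
  have := enormD (- (l - f t)) l; rewrite enormN opprB subrK; lra.
have := enormD (l - f t) (f t); rewrite subrK; lra.
Qed.

Lemma eball_convex (c x y : 'rV[R]_n) (rho k : R) : 0 <= k <= 1 ->
  eball c rho x -> eball c rho y -> eball c rho (x + k *: (y - x)).
Proof.
move=> /andP[k0 k1] xc yc; rewrite /eball /=.
have -> : x + k *: (y - x) - c = (1 - k) *: (x - c) + k *: (y - c).
  by apply/matrixP => i j; rewrite !mxE; ring.
rewrite (le_trans (enormD _ _))// !enormZ !ger0_norm ?subr_ge0//.
rewrite /eball /= in xc yc; nra.
Qed.

Lemma sqr_enorm_midpoint (x y : 'rV[R]_n) :
  enorm (2^-1 *: (x + y)) ^+ 2 =
  (enorm x ^+ 2 + enorm y ^+ 2) / 2 - enorm (x - y) ^+ 2 / 4.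
Proof.
rewrite !sqr_enorm !mulr_suml.
rewrite -big_split /= mulr_suml -sumrB; apply: eq_bigr => i _.
by rewrite !mxE; field.
Qed.

End Euclidean.
(** * Convexity of the image of an intersection of balls *)

Section ConvexImage.
Context {R : realType} {n : nat}.
Variables (X : set 'rV[R]_n) (Phi : 'rV[R]_n -> 'rV[R]_n) (M : 'rV[R]_n -> 'M[R]_n).
Hypothesis openX : open X.
Hypothesis injPhi : forall x y, X x -> X y -> Phi x = Phi y -> x = y.
Hypothesis unitM : forall x, X x -> M x \in unitmx.
Hypothesis diffPhi : forall x (eps : R), X x -> 0 < eps ->
  exists2 eta : R, 0 < eta & forall h, `|h| < eta ->
    `|Phi (x + h) - Phi x - h *m M x| <= eps * `|h|.

Let n1_gt0 : 0 < n%:R + 1 :> R.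
Proof. by rewrite ltr_wpDl. Qed.

Lemma Phi_continuous x : X x -> Phi y @[y --> x] --> Phi x.
Proof.
move=> Xx; apply/(@cvgrPdist_le _ _ _ (nbhs x) (nbhs_filter x)) => e e0.
have [eta eta0 H] := diffPhi Xx ltr01.
pose C := 1 + n%:R * `|M x|.
have C0 : 0 < C by rewrite ltr_wpDr// mulr_ge0.
have : \forall y \near x, `|x - y| < Num.min eta (e / C).
  apply/nbhs_ballP; exists (Num.min eta (e / C)) => /=.
    by rewrite lt_min eta0 divr_gt0.
  by move=> y; rewrite -ball_normE.
apply: filterS => y; rewrite lt_min distrC => /andP[y1 y2].
have := H _ y1; rewrite [x + _]addrC subrK mul1r => h.
rewrite distrC; have -> : Phi y - Phi x =
  (Phi y - Phi x - (y - x) *m M x) + (y - x) *m M x by rewrite subrK.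
rewrite (le_trans (ler_normD _ _))//.
apply: (@le_trans _ _ (C * `|y - x|)).
  rewrite mulrDl mul1r lerD// (le_trans (mx_norm_mul _ _))//.
  by rewrite -mulrA ler_wpM2l// mulrC.
by rewrite mulrC -ler_pdivlMr// ltW.
Qed.

Let within_Phi (K : set 'rV[R]_n) : K `<=` X -> {within K, continuous Phi}.
Proof.
move=> KX; apply: continuous_in_subspaceT => x; rewrite inE => Kx.
exact: Phi_continuous (KX _ Kx).
Qed.

(** A point of [K] where the distance of [Phi] to [y] is least is interior to
    [K] when [y] is close enough to [Phi w]; as the derivative there is
    invertible, the distance could be decreased unless it is zero. *)
Lemma local_surjectivity (K L : set 'rV[R]_n) : K `<=` X -> compact K ->
  compact L -> L `<=` K° ->
  exists2 kappa : R, 0 < kappa & forall w y, L w -> `|y - Phi w| < kappa ->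
    exists2 x, K x & Phi x = y.
Proof.
move=> KX cK cL LK.
pose B := K `&` ~` K°.
have LX : L `<=` X by move=> x /LK/interior_subset/KX.
have BX : B `<=` X by move=> x [/KX].
have cB : compact B.
  apply: compact_closedI => //.
  by apply: open_closedC; exact: open_interior.
have [mu mu0 Hmu] : exists2 mu : R, 0 < mu &
    forall a w, B a -> L w -> mu <= `|Phi a - Phi w|.
  have [[z [Bz Lz]]|none] := pselect (exists z : _ * _, B z.1 /\ L z.2); last first.
    by exists 1 => // a w Ba Lw; exfalso; apply: none; exists (a, w).
  have cBL : compact (B `*` L) by exact: compact_setX.
  have [|||m mBL Hm] := @compact_EVT_min _ R
    (fun z : _ * _ => `|Phi z.1 - Phi z.2|) (B `*` L).
  - by exists z.
  - exact: cBL.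
  - apply: continuous_in_subspaceT => -[u w]; rewrite inE => -[/= Bu Lw].
    apply: cvg_norm; apply: cvgB.
      by apply: cvg_comp (Phi_continuous (BX _ Bu)); exact: cvg_fst.
    by apply: cvg_comp (Phi_continuous (LX _ Lw)); exact: cvg_snd.
  - move: mBL; rewrite inE => -[Bm Lm].
    exists `|Phi m.1 - Phi m.2|.
      rewrite normr_gt0 subr_eq0; apply/eqP => /injPhi e.
      have em : m.1 = m.2 by apply: e; [exact: BX|exact: LX].
      by case: Bm => _; apply; rewrite em; exact: LK.
    by move=> a w Ba Lw; apply: (Hm (a, w)); rewrite inE.
exists (mu / (n%:R + 3)); first by rewrite divr_gt0// ltr_wpDl.
move=> w y Lw yw.
have Kw : K w by exact: (interior_subset (LK _ Lw)).
have [|||x Kx xmin] := @compact_EVT_min _ R (fun x => enorm (Phi x - y)) K.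
- by exists w.
- exact: cK.
- move=> x; apply: cvg_enorm; apply: cvgB; last exact: cvg_cst.
  exact: within_Phi.
rewrite inE in Kx; have Xx := KX _ Kx.
have n3 : 0 < n%:R + 3 :> R by rewrite ltr_wpDl.
have xw : enorm (Phi x - y) <= enorm (Phi w - y) by apply: xmin; rewrite inE.
have intx : K° x.
  apply: contrapT => nx; have Bx : B x by [].
  have h1 := Hmu _ _ Bx Lw.
  have h2 := le_trans (norm_le_enorm _) (le_trans xw (enorm_le_norm _)).
  rewrite ltr_pdivlMr// in yw.
  have h3 : `|Phi x - Phi w| <= `|Phi x - y| + `|y - Phi w|.
    by rewrite (le_trans _ (ler_normD _ _))// addrA subrK.
  rewrite [`|Phi w - y|]distrC in h2.
  have n0 : 0 <= n%:R :> R by [].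
  have := normr_ge0 (y - Phi w).
  nra.
exists x => //; apply/eqP; rewrite -subr_eq0; apply/eqP.
set u := Phi x - y.
apply: contrapT => /eqP u0.
have E0 : 0 < enorm u.
  by rewrite lt_neqAle enorm_ge0 andbT eq_sym; apply: contra_neq u0; exact: enorm_eq0.
(* to first order, a step along [h] decreases [Phi x - y = u] radially *)
pose h := - u *m invmx (M x).
have hM : h *m M x = - u by rewrite /h mulmxKV// unitM.
have H0 : 0 < `|h| + 1 by rewrite ltr_wpDl.
pose eps := enorm u / 2 / ((n%:R + 1) * (`|h| + 1)).
have eps0 : 0 < eps by rewrite !divr_gt0// mulr_gt0.
have [eta eta0 Heta] := diffPhi Xx eps0.
have : \forall z \near x, K z by exact: intx.
move=> /nbhs_ballP[de /= de0 Hde].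
pose s := Num.min 1 (Num.min eta de / 2 / (`|h| + 1)).
have me0 : 0 < Num.min eta de by rewrite lt_min eta0.
have s0 : 0 < s by rewrite lt_min ltr01 !divr_gt0.
have s1 : s <= 1 by rewrite /s ge_min lexx.
have sh : `|s *: h| < Num.min eta de.
  rewrite normrZ gtr0_norm//.
  have : s * (`|h| + 1) <= Num.min eta de / 2.
    by rewrite -ler_pdivlMr// /s ge_min lexx orbT.
  have := normr_ge0 h; nra.
move: sh; rewrite lt_min => /andP[sh1 sh2].
have Kz : K (x + s *: h).
  by apply: Hde; rewrite -ball_normE /= opprD addrA subrr add0r normrN.
have := xmin (x + s *: h); rewrite inE => /(_ Kz); rewrite -/u.
have := Heta _ sh1; rewrite -scalemxAl hM.
set er := (X in `|X| <= _) => her.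
have -> : Phi (x + s *: h) - y = (1 - s) *: u + er.
  by rewrite /er /u; apply/matrixP => i j; rewrite !mxE; ring.
have h1 := enormD ((1 - s) *: u) er.
rewrite enormZ ger0_norm ?subr_ge0// in h1.
have h2 : enorm er <= (n%:R + 1) * (eps * (s * `|h|)).
  rewrite (le_trans (enorm_le_norm _))// ler_wpM2l ?(ltW n1_gt0)//.
  by rewrite (le_trans her)// normrZ gtr0_norm.
have h3 : (n%:R + 1) * (eps * (s * (`|h| + 1))) = s * (enorm u / 2).
  by rewrite /eps; field; rewrite !gt_eqF.
have h4 : (n%:R + 1) * (eps * (s * `|h|)) <= s * (enorm u / 2).
  rewrite -h3 ler_wpM2l ?(ltW n1_gt0)// ler_wpM2l ?(ltW eps0)//.
  by rewrite ler_wpM2l ?(ltW s0)// lerDl.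
have h5 := mulr_gt0 s0 E0.
move=> h6; lra.
Qed.

Variables (C : set 'rV[R]_n) (r L2 : R) (Q : 'rV[R]_n -> 'rV[R]_n -> 'rV[R]_n).
Hypothesis C0 : C !=set0.
Hypothesis r0 : 0 < r.

Let Om (rho : R) := \bigcap_(c in C) eball c rho.
Hypothesis OmX : Om r `<=` X.
Hypothesis taylorPhi : forall x (eps : R), Om r x -> 0 < eps ->
  exists2 eta : R, 0 < eta & forall h, `|h| < eta ->
    `|Phi (x + h) - Phi x - (h + 2^-1 *: Q x h) *m M x| <= eps * `|h| ^+ 2.
Hypothesis boundQ : forall x h, Om r x -> enorm (Q x h) <= L2 * enorm h ^+ 2.
Hypothesis rL2 : r * L2 <= 1.

Lemma balls_compact rho : compact (Om rho).
Proof.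
have [c Cc] := C0.
apply: bounded_closed_compact.
  exists (`|c| + rho); split; first exact: num_real.
  move=> B HB x /(_ c Cc); rewrite /eball /= => xc.
  apply: ltW; apply: le_lt_trans HB.
  have -> : x = c + (x - c) by rewrite addrC subrK.
  by rewrite (le_trans (ler_normD _ _))// lerD2l (le_trans (norm_le_enorm _)).
apply: closed_bigI => d _.
rewrite (_ : eball d rho = (fun x => enorm (x - d)) @^-1` [set y | y <= rho])//.
apply: preimage_closed => [x _|]; last exact: closed_le.
apply: (@cvg_enorm _ _ _ (nbhs x) (nbhs_filter x)).
by apply: cvgB; [exact: cvg_id|exact: cvg_cst].
Qed.

Lemma balls_subset rho rho' : rho <= rho' -> Om rho `<=` Om rho'.
Proof. by move=> h x xO c Cc; exact: le_trans (xO c Cc) h. Qed.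

Lemma balls_interior rho rho' : rho < rho' -> Om rho `<=` (Om rho')°.
Proof.
move=> h x xO; apply/nbhs_ballP; exists ((rho' - rho) / (n%:R + 1)) => /=.
  by rewrite divr_gt0// subr_gt0.
move=> y; rewrite -ball_normE /= distrC ltr_pdivlMr// => xy c Cc.
rewrite /eball /=; have -> : y - c = (y - x) + (x - c) by rewrite addrA subrK.
rewrite (le_trans (enormD _ _))//.
have := enorm_le_norm (y - x); have := xO c Cc; rewrite /eball /=; lra.
Qed.

Let seg (a b : 'rV[R]_n) (l : R) := a + l *: (b - a).

Let on_seg rho a b := forall l, 0 <= l <= 1 ->
  exists2 x, Om rho x & Phi x = seg (Phi a) (Phi b) l.

(** The preimage of the segment stays in a ball of radius [rho] about [c] as
    soon as its end points do: at an interior point [x] of the preimage, [h]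
    being the increment to a nearby point of the preimage, [h + Q x h / 2] is up
    to [o(|h|^2)] an increment of fixed direction, hence on one of the two sides
    [|x + h - c|^2 - |x - c|^2] is at least
    [|h|^2 - (x - c, Q x h) - o(|h|^2) > 0]. *)
Lemma segment_preimage_ball rho rho' a0 a1 c : rho < rho' -> rho' < r -> C c ->
  Om rho a0 -> Om rho a1 -> on_seg rho' a0 a1 ->
  forall x l, Om rho' x -> 0 <= l <= 1 -> Phi x = seg (Phi a0) (Phi a1) l ->
  eball c rho x.
Proof.
move=> rr' r'r Cc Oa0 Oa1 onseg x l Ox l01 xl.
have OX : Om rho' `<=` X by move=> y /(balls_subset (ltW r'r)); exact: OmX.
have O'a0 := balls_subset (ltW rr') Oa0; have O'a1 := balls_subset (ltW rr') Oa1.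
pose w := Phi a1 - Phi a0.
have [w0|w0] := eqVneq w 0.
  have xa : x = a0.
    by apply: injPhi; [exact: OX|exact: OX|rewrite xl /seg -/w w0 scaler0 addr0].
  by rewrite xa; exact: Oa0.
pose S := [set Phi a0 + l *: w | l in `[0, 1]].
have cS : compact S.
  apply: continuous_compact; last exact: segment_compact.
  apply: continuous_subspaceT => k; apply: cvgD; first exact: cvg_cst.
  by apply: cvgZr_tmp; exact: cvg_id.
have closedS : closed S by apply: compact_closed => //; exact: norm_hausdorff.
pose Sg := Om rho' `&` Phi @^-1` S.
have cSg : compact Sg.
  apply: compact_preimage => //; first exact: balls_compact.
  exact: within_Phi.
have [|||y ySg ymax] := @compact_EVT_max _ R (fun x : 'rV[R]_n => enorm (x - c)) Sg.
- by exists a0; split => //; exists 0; rewrite /= ?scale0r ?addr0// in_itv /= lexx ler01.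
- exact: cSg.
- apply: continuous_subspaceT => z.
  apply: (@cvg_enorm _ _ _ (nbhs z) (nbhs_filter z)).
  by apply: cvgB; [exact: cvg_id|exact: cvg_cst].
suff yc : eball c rho y.
  rewrite /eball /=; apply: le_trans yc; apply: ymax; rewrite inE; split => //.
  by exists l => //=; rewrite in_itv.
move: ySg; rewrite inE => -[Oy [ly /=]]; rewrite in_itv /= => /andP[ly0 ly1] yE.
have Xy := OX _ Oy; have Ory := balls_subset (ltW r'r) Oy.
have [ly00|ly00] := eqVneq ly 0.
  have -> : y = a0.
    by apply: injPhi => //; [exact: OX|rewrite -yE ly00 scale0r addr0].
  exact: Oa0.
have [ly11|ly11] := eqVneq ly 1.
  have -> : y = a1.
    by apply: injPhi => //; [exact: OX|rewrite -yE ly11 scale1r /w addrC subrK].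
  exact: Oa1.
exfalso.
have l0 : 0 < ly by rewrite lt_neqAle eq_sym ly00.
have l1 : ly < 1 by rewrite lt_neqAle ly11.
pose a := y - c; pose k := w *m invmx (M y).
have aR : enorm a <= rho' := Oy c Cc.
have rho'0 : 0 <= rho' := le_trans (enorm_ge0 _) aR.
pose m := 1 - rho' * L2.
have m0 : 0 < m.
  rewrite /m subr_gt0; have [L0|L0] := leP L2 0.
    by rewrite (le_lt_trans (mulr_ge0_le0 rho'0 L0)).
  by apply: lt_le_trans rL2; rewrite ltr_pM2r.
pose D := 2 * (rho' + 1) * (n%:R + 1) * (n%:R * (`|invmx (M y)| + 1) + 1).
have D0 : 0 < D.
  by rewrite !mulr_gt0// ?ltr_wpDl// mulr_ge0// addr_ge0.
pose eps := m / 2 / D.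
have eps0 : 0 < eps by rewrite !divr_gt0.
have [eta eta0 Heta] := taylorPhi Ory eps0.
have : \forall z \near y, X z by exact: open_nbhs_nbhs.
move=> /nbhs_ballP[de /= de0 Hde].
pose eta' := Num.min eta de / 2.
have me0 : 0 < Num.min eta de by rewrite lt_min eta0.
have eta'0 : 0 < eta' by rewrite divr_gt0.
have e'm : eta' < Num.min eta de by rewrite /eta'; lra.
have e'eta : eta' < eta by move: e'm; rewrite lt_min => /andP[].
have e'de : eta' < de by move: e'm; rewrite lt_min => /andP[].
pose K := [set z : 'rV[R]_n | `|z - y| <= eta'].
have KX : K `<=` X.
  by move=> z Kz; apply: Hde; rewrite -ball_normE /= distrC (le_lt_trans Kz).
have cK : compact K.
  apply: bounded_closed_compact.
    exists (`|y| + eta'); split; first exact: num_real.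
    move=> B HB z Kz; apply: ltW; apply: le_lt_trans HB.
    have -> : z = y + (z - y) by rewrite addrC subrK.
    by rewrite (le_trans (ler_normD _ _))// lerD2l.
  rewrite (_ : K = (fun z => `|z - y|) @^-1` [set t | t <= eta'])//.
  apply: preimage_closed => [z _|]; last exact: closed_le.
  apply: (@cvg_norm _ _ _ (nbhs z) (nbhs_filter z)).
  by apply: cvgB; [exact: cvg_id|exact: cvg_cst].
have yK : [set y] `<=` K°.
  move=> z ->; apply/nbhs_ballP; exists eta' => //= z'.
  by rewrite -ball_normE /= distrC => /ltW.
have [kappa kappa0 Hka] := local_surjectivity KX cK (@compact_set1 _ y) yK.
(* the side on which the first-order increment of the distance is >= 0 *)
have [sg sgk sgn] : exists2 sg : R, 0 <= sg * dotp a k & `|sg| = 1.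
  have [h|h] := leP 0 (dotp a k); first by exists 1; rewrite ?mul1r ?normr1.
  by exists (-1); rewrite ?normrN1// mulN1r oppr_ge0 ltW.
have W0 : 0 < `|w| + 1 by rewrite ltr_wpDl.
pose st := Num.min (Num.min ly (1 - ly)) (kappa / (`|w| + 1)) / 2.
have mn0 : 0 < Num.min (Num.min ly (1 - ly)) (kappa / (`|w| + 1)).
  by rewrite !lt_min l0 subr_gt0 l1 divr_gt0.
have st0 : 0 < st by rewrite divr_gt0.
have : st < Num.min (Num.min ly (1 - ly)) (kappa / (`|w| + 1)) by rewrite /st; lra.
rewrite !lt_min => /andP[/andP[st1 st2] st3].
rewrite ltr_pdivlMr// in st3.
have sst : `|sg * st| = st by rewrite normrM sgn mul1r gtr0_norm.
pose l' := ly + sg * st.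
have l'01 : 0 <= l' <= 1.
  have := ler_norm (sg * st); have := ler_norm (- (sg * st)).
  rewrite normrN sst /l' => ? ?; apply/andP; split; lra.
have [|z Kz zE] := Hka y (Phi a0 + l' *: w) erefl.
  rewrite -yE /l' opprD addrACA subrr add0r scalerDl [ly *: w + _]addrC addrK.
  by rewrite normrZ sst; have := normr_ge0 w; nra.
have [z' Oz' z'E] := onseg l' l'01.
have zz' : z = z'.
  by apply: injPhi; [exact: KX|exact: OX|rewrite zE z'E].
have Sz : Sg z.
  by rewrite zz'; split => //; exists l' => //=; rewrite in_itv.
have := ymax z; rewrite inE => /(_ Sz) zmax.
pose h := z - y.
have hE : y + h = z by rewrite /h addrC subrK.
have h0 : h != 0.
  apply: contra_neq w0 => hz; have zy : z = y by rewrite -hE hz addr0.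
  have : sg * st != 0 by rewrite -normr_gt0 sst.
  move=> ss0; apply: (scalerI ss0); rewrite scaler0.
  move: zE; rewrite zy -yE /l' scalerDl addrA => /esym/eqP.
  by rewrite -[X in _ == X]addr0 (inj_eq (addrI _)) => /eqP.
have := Heta h (le_lt_trans Kz e'eta); rewrite hE.
have -> : Phi z - Phi y = (sg * st) *: w.
  by rewrite zE -yE /l' opprD addrACA subrr add0r scalerDl [ly *: w + _]addrC addrK.
set E := (X in `|X| <= _) => HE.
have EM : (sg * st) *: k = h + 2^-1 *: Q y h + E *m invmx (M y).
  rewrite /E mulmxBl -scalemxAl -/k mulmxK ?unitM//.
  by rewrite addrC subrK.
have hh : enorm (a + h) <= enorm a.
  have -> : a + h = z - c by apply/matrixP => i j; rewrite !mxE; ring.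
  exact: zmax.
have H0 : 0 < enorm h.
  by rewrite lt_neqAle enorm_ge0 andbT eq_sym; apply: contra_neq h0; exact: enorm_eq0.
have HQ : dotp a (Q y h) <= rho' * (L2 * enorm h ^+ 2).
  apply: (le_trans (cauchy_schwarz _ _)).
  by apply: ler_pM; rewrite ?enorm_ge0//; exact: boundQ.
have HEM : dotp a (E *m invmx (M y)) <= m / 4 * enorm h ^+ 2.
  apply: (le_trans (cauchy_schwarz _ _)).
  have e1 : enorm (E *m invmx (M y)) <=
      (n%:R + 1) * (n%:R * (eps * enorm h ^+ 2 * `|invmx (M y)|)).
    apply: (le_trans (enorm_le_norm _)); rewrite ler_wpM2l ?(ltW n1_gt0)//.
    apply: (le_trans (mx_norm_mul _ _)); rewrite ler_wpM2l// ler_wpM2r//.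
    apply: (le_trans HE); rewrite ler_wpM2l ?(ltW eps0)// lerXn2r ?nnegrE ?enorm_ge0//.
    exact: norm_le_enorm.
  apply: (le_trans (ler_pM (enorm_ge0 _) (enorm_ge0 _) aR e1)).
  have -> : m / 4 = eps * D / 2 by rewrite /eps divfK ?gt_eqF//; field.
  have -> : rho' * ((n%:R + 1) * (n%:R * (eps * enorm h ^+ 2 * `|invmx (M y)|))) =
     eps * (rho' * (n%:R + 1) * (n%:R * `|invmx (M y)|)) * enorm h ^+ 2 by ring.
  rewrite ler_wpM2r ?sqr_ge0// -[eps * D / 2]mulrA ler_wpM2l ?(ltW eps0)//.
  have -> : D / 2 = (rho' + 1) * (n%:R + 1) * (n%:R * (`|invmx (M y)| + 1) + 1).
    by rewrite /D; field.
  rewrite ler_pM ?mulr_ge0 ?(ltW n1_gt0)//; first by rewrite ler_wpM2r ?(ltW n1_gt0)// lerDl.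
  have n0 : 0 <= n%:R :> R by []; nra.
have dE : st * (sg * dotp a k) = dotp a h + 2^-1 * dotp a (Q y h) + dotp a (E *m invmx (M y)).
  by rewrite mulrA [st * sg]mulrC -dotpZ EM !dotpD dotpZ.
have h1 : enorm (a + h) ^+ 2 <= enorm a ^+ 2 by rewrite lerXn2r ?nnegrE ?enorm_ge0.
rewrite sqr_enormD in h1.
have h2 := mulr_ge0 (ltW st0) sgk.
have h3 : 0 < m * enorm h ^+ 2 by rewrite mulr_gt0// exprn_gt0.
have h4 : m * enorm h ^+ 2 = enorm h ^+ 2 - rho' * (L2 * enorm h ^+ 2) by rewrite /m; ring.
lra.
Qed.

(** The segment from [Phi z0] to [Phi (z0 + l (z1 - z0))] is followed from
    [l = 0] to [l = 1] by finitely many small steps: each step leads from points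
    of [Phi (Om rho)] to points of [Phi (Om rho')] by local surjectivity, hence
    back to points of [Phi (Om rho)]. *)
Lemma segment_in_image rho z0 z1 : rho < r -> Om rho z0 -> Om rho z1 ->
  on_seg rho z0 z1.
Proof.
move=> rr O0 O1.
pose rho' := (rho + r) / 2.
have rr' : rho < rho' by rewrite /rho'; lra.
have r'r : rho' < r by rewrite /rho'; lra.
have OX : Om rho' `<=` X by move=> y /(balls_subset (ltW r'r)); exact: OmX.
have [ka ka0 Hka] := local_surjectivity OX (@balls_compact rho')
  (@balls_compact rho) (balls_interior rr').
pose zl l := seg z0 z1 l.
have Ozl l : 0 <= l <= 1 -> Om rho (zl l).
  by move=> l01 c Cc; apply: eball_convex => //; [exact: O0|exact: O1].
have step l l' : 0 <= l <= 1 -> 0 <= l' <= 1 ->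
    `|Phi (zl l') - Phi (zl l)| < ka -> on_seg rho z0 (zl l) -> on_seg rho z0 (zl l').
  move=> l01 l'01 small IH.
  have big : on_seg rho' z0 (zl l').
    move=> k k01; have [x Ox xE] := IH k k01.
    have [|x' Ox' x'E] := Hka x (seg (Phi z0) (Phi (zl l')) k) Ox; last by exists x'.
    apply: le_lt_trans small; rewrite xE /seg.
    have -> : Phi z0 + k *: (Phi (zl l') - Phi z0) -
      (Phi z0 + k *: (Phi (zl l) - Phi z0)) = k *: (Phi (zl l') - Phi (zl l)).
      by apply/matrixP => i j; rewrite !mxE; ring.
    by rewrite normrZ; case/andP: k01 => k0 k1; rewrite ger0_norm// ler_piMl.
  move=> k k01; have [x Ox xE] := big k k01; exists x => // c Cc.
  exact: (segment_preimage_ball rr' r'r Cc O0 (Ozl _ l'01) big Ox k01 xE).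
(* uniform continuity, which makes the number of steps finite *)
have [N N0 HN] : exists2 N : nat, (0 < N)%N & forall l l', 0 <= l <= 1 -> 0 <= l' <= 1 ->
    `|l' - l| <= N%:R^-1 -> `|Phi (zl l') - Phi (zl l)| < ka.
  have := @segment_compact R 0 1.
  move=> /compact_near_coveringP/near_covering_withinP.
  move=> /(_ nat (nbhs \oo) (fun N l => forall l', 0 <= l' <= 1 ->
    `|l' - l| <= N.+1%:R^-1 -> `|Phi (zl l') - Phi (zl l)| < ka)) H.
  have [N0 _ HN] : \forall N \near \oo, `[0, 1] `<=` (fun l => forall l',
      0 <= l' <= 1 -> `|l' - l| <= N.+1%:R^-1 -> `|Phi (zl l') - Phi (zl l)| < ka).
    apply: H => l; rewrite /= in_itv /= => l01.
    have ka2 : 0 < ka / 2 by rewrite divr_gt0.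
    have Xl : X (zl l) by apply: OX; exact: balls_subset (ltW rr') _ (Ozl l l01).
    have cz : zl y @[y --> l] --> zl l.
      by apply: cvgD; [exact: cvg_cst|apply: cvgZr_tmp; exact: cvg_id].
    have := cvg_comp _ _ cz (Phi_continuous Xl).
    move=> /cvgrPdist_lt/(_ _ ka2)/nbhs_ballP[de /= de0 Hde].
    have de2 : 0 < de / 2 by rewrite divr_gt0.
    exists (ball l (de / 2), [set N | N.+1%:R^-1 < de / 2]).
      by split => /=; [exact: nbhsx_ballx|exact: near_infty_natSinv_lt (PosNum de2)].
    move=> [l1 N] [/=]; rewrite -ball_normE /= => ll1 Nde _ l2 l201 l12.
    have h1 : `|Phi (zl l) - Phi (zl l1)| < ka / 2.
      by apply: Hde; rewrite -ball_normE /=; lra.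
    have h2 : `|Phi (zl l) - Phi (zl l2)| < ka / 2.
      apply: Hde; rewrite -ball_normE /=.
      have -> : l - l2 = (l - l1) - (l2 - l1) by ring.
      apply: le_lt_trans (ler_normB _ _) _.
      by rewrite (splitr de) ltrD// (le_lt_trans l12).
    have -> : Phi (zl l2) - Phi (zl l1) =
      (Phi (zl l) - Phi (zl l1)) - (Phi (zl l) - Phi (zl l2)).
      by apply/matrixP => i j; rewrite !mxE; ring.
    apply: le_lt_trans (ler_normB _ _) _.
    by rewrite (splitr ka) ltrD.
  exists N0.+1 => // l l' l01 l'01.
  by apply: (HN N0) => //=.
have all j : (j <= N)%N -> on_seg rho z0 (zl (j%:R / N%:R)).
  have N0' : 0 < N%:R :> R by rewrite ltr0n.
  elim: j => [|j IH] jN.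
    move=> k k01; exists z0 => //.
    by rewrite /zl mul0r /seg scale0r addr0 subrr scaler0 addr0.
  have jI i : (i <= N)%N -> 0 <= (i%:R / N%:R : R) <= 1.
    by move=> iN; rewrite divr_ge0//= ler_pdivrMr// mul1r ler_nat.
  apply: (step (j%:R / N%:R)); [exact/jI/ltnW|exact: jI| |exact/IH/ltnW].
  apply: HN; [exact/jI/ltnW|exact: jI|].
  rewrite -mulrBl -natr1 [j%:R + 1]addrC addrK mul1r ger0_norm// invr_ge0//.
have := all N (leqnn N); rewrite divff ?pnatr_eq0 -?lt0n//.
by rewrite /zl /seg scale1r [z0 + _]addrC subrK.
Qed.

(** The contraction by a factor [th < 1] towards the midpoint of [x0] and [x1]
    moves both points into some [Om rho] with [rho < r], where
    [segment_in_image] applies; [th] then tends to 1. *)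
Lemma convex_image : convex_set (Phi @` Om r).
Proof.
move=> p0 p1 la; rewrite !inE => -[x0 O0 <-] [x1 O1 <-] {p0 p1}.
have [k k01 ->] : exists2 k : R, 0 <= k <= 1 &
    conv la (Phi x0 : convex_lmodType 'rV[R]_n) (Phi x1) = seg (Phi x0) (Phi x1) k.
  exists (1 - la%:num).
    by apply/andP; split; rewrite ?subr_ge0 ?lerBlDl ?lerDr.
  rewrite /seg; have -> : conv la (Phi x0 : convex_lmodType 'rV[R]_n) (Phi x1) =
    la%:num *: Phi x0 + (1 - la%:num) *: Phi x1 by [].
  by apply/matrixP => i j; rewrite !mxE; ring.
have [->|x01] := eqVneq x0 x1.
  by exists x1 => //; rewrite /seg subrr scaler0 addr0.
(* by the parallelogram identity the midpoint is well inside all the balls *)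
pose e := 2^-1 *: (x0 + x1).
pose rho0 := Num.sqrt (r ^+ 2 - enorm (x0 - x1) ^+ 2 / 4).
have D0 : 0 < enorm (x0 - x1).
  rewrite lt_neqAle enorm_ge0 andbT eq_sym; apply: contra_neq x01 => /enorm_eq0.
  by move=> /eqP; rewrite subr_eq0 => /eqP.
have rho0r : rho0 < r.
  have rE : r = Num.sqrt (r ^+ 2) by rewrite sqrtr_sqr gtr0_norm.
  rewrite [ltRHS]rE /rho0.
  have h : 0 < enorm (x0 - x1) ^+ 2 / 4 by rewrite divr_gt0// exprn_gt0.
  by rewrite ltr_sqrt ?exprn_gt0//; lra.
have eO : Om rho0 e.
  move=> c Cc; rewrite /eball /= /rho0 -[enorm (e - c)]ger0_norm ?enorm_ge0//.
  rewrite -sqrtr_sqr ler_wsqrtr//.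
  have -> : e - c = 2^-1 *: ((x0 - c) + (x1 - c)).
    by apply/matrixP => i j; rewrite !mxE; field.
  rewrite sqr_enorm_midpoint.
  have -> : x0 - c - (x1 - c) = x0 - x1 by apply/matrixP => i j; rewrite !mxE; ring.
  have rn x : Om r x -> enorm (x - c) ^+ 2 <= r ^+ 2.
    by move=> Ox; rewrite lerXn2r ?nnegrE ?enorm_ge0 ?(ltW r0)//; exact: Ox.
  have := rn _ O0; have := rn _ O1; lra.
pose z (x : 'rV[R]_n) (th : R) := e + th *: (x - e).
have zO x th : Om r x -> 0 <= th < 1 -> exists2 rho, rho < r & Om rho (z x th).
  move=> Ox /andP[th0 th1]; exists (th * r + (1 - th) * rho0); first nra.
  move=> c Cc; rewrite /eball /= /z.
  have -> : e + th *: (x - e) - c = th *: (x - c) + (1 - th) *: (e - c).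
    by apply/matrixP => i j; rewrite !mxE; ring.
  rewrite (le_trans (enormD _ _))// !enormZ !ger0_norm ?subr_ge0 ?(ltW th1)//.
  have := Ox c Cc; have := eO c Cc; rewrite /eball /= => h1 h2.
  by rewrite lerD// ler_wpM2l// subr_ge0 ltW.
have inS th : 0 <= th < 1 -> (Phi @` Om r) (seg (Phi (z x0 th)) (Phi (z x1 th)) k).
  move=> th01; have [r0' r0r O0'] := zO x0 th O0 th01.
  have [r1' r1r O1'] := zO x1 th O1 th01.
  have mr : Num.max r0' r1' < r by rewrite gt_max r0r.
  have [||y Oy yE] := segment_in_image mr (z0 := z x0 th) (z1 := z x1 th) _ _ k01.
  - by apply: balls_subset O0'; rewrite le_max lexx.
  - by apply: balls_subset O1'; rewrite le_max lexx orbT.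
  - by exists y => //; exact: balls_subset (ltW mr) _ Oy.
have cP : closed (Phi @` Om r).
  apply: compact_closed; first exact: norm_hausdorff.
  by apply: continuous_compact; [exact: within_Phi|exact: balls_compact].
have cz x : z x th @[th --> 1^'-] --> x.
  have {2}-> : x = e + 1 *: (x - e) by rewrite scale1r addrC subrK.
  apply: cvgD; first exact: cvg_cst.
  by apply: cvgZr_tmp; exact: cvg_within.
have cPz x : Om r x -> Phi (z x th) @[th --> 1^'-] --> Phi x.
  by move=> Ox; apply: cvg_comp (cz x) _; exact: Phi_continuous (OmX Ox).
have : seg (Phi (z x0 th)) (Phi (z x1 th)) k @[th --> 1^'-] --> seg (Phi x0) (Phi x1) k.
  apply: cvgD; first exact: cPz.
  by apply: cvgZl_tmp; apply: cvgB; exact: cPz.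
apply: closed_cvg => //.
near=> th; apply: inS; apply/andP; split; last by near: th; exact: nbhs_left_lt.
near: th; apply: nbhs_left_ge; exact: ltr01.
Unshelve. all: by end_near. Qed.

End ConvexImage.
(** * The general solution *)

Section FlowOfSolutions.
Context {R : realType}.

Lemma jacobian_small_o n p (f : 'rV[R]_n -> 'rV[R]_p) x (A : 'M[R]_(n, p)) :
  (forall eps : R, 0 < eps -> exists2 eta : R, 0 < eta & forall h, `|h| < eta ->
     `|f (x + h) - f x - h *m A| <= eps * `|h|) ->
  'J f x = A.
Proof.
move=> H.
have cA : continuous (mulmxr A : 'rV[R]_n -> 'rV[R]_p).
  move=> y; apply: (@cvg_mulmx _ _ (nbhs y) (nbhs_filter y)); [exact: cvg_id|exact: cvg_cst].
have -> : A = lin1_mx (mulmxr A : 'rV[R]_n -> 'rV[R]_p).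
  by apply/row_matrixP => i; rewrite !rowE mul_rV_lin1.
rewrite /jacobian; congr lin1_mx.
apply: (@diff_unique _ _ _ f (mulmxr A) x cA).
apply: eqaddoE; apply/eqaddoP => _/posnumP[e].
have [eta eta0 He] := H e%:num ltac:(by []).
suff : \forall h \near (0 : 'rV[R]_n),
  `|(f \o shift x - (cst (f x) + mulmxr A)) h| <= e%:num * `|h| by [].
apply/nbhs_norm0P; exists eta => //= h /He /=.
by rewrite fctE /= /cst /= [h + x]addrC opprD addrA.
Qed.

Variables (n m : nat) (X : set 'rV[R]_n) (V : set 'rV[R]_m).
Variables (F : 'rV[R]_n -> 'rV[R]_m -> 'rV[R]_n).
Hypothesis openX : open X.
Hypothesis C1F : C1_fst X V F.
Variables (s : seq R) (b : R) (v : R -> 'rV[R]_m).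
Hypothesis b0 : 0 < b.
Hypothesis regv : regulated V s b v.
Hypothesis extF : forall p, X p -> exists x, is_solution X F p v x.

Let phi t p := general_solution X F t p v.

Lemma solution_trajectory p x : is_solution X F p v x -> trajectory X F s b v x.
Proof.
move=> [x0 xX cx dx]; split; first by move=> t /andP[t0 _]; exact: xX.
split.
  apply: continuous_subspaceW cx => t /=; rewrite !in_itv /= => /andP[-> _].
  by [].
move=> t /andP[t0 tb] ts; apply: dx => //; have [_ vc _ _] := regv.
by apply: vc; rewrite ?t0.
Qed.

Lemma general_solutionP p : X p -> phi 0 p = p /\ trajectory X F s b v (phi ^~ p).
Proof.
move=> Xp; have [x xs] := extF Xp.
have [] : is_solution X F p v (phi ^~ p).
  by rewrite /phi /general_solution; exact: (xgetPex (fun=> 0) (ex_intro _ x xs)).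
by move=> p0 h1 h2 h3; split => //; apply: (@solution_trajectory p); split.
Qed.

Let extT p : X p -> exists2 x, x 0 = p & trajectory X F s b v x.
Proof. by move=> /general_solutionP[h1 h2]; exists (phi ^~ p). Qed.

Let near_X p : X p -> exists2 eta : R, 0 < eta & forall h, `|h| < eta -> X (p + h).
Proof.
move=> Xp; have : \forall z \near p, X z by exact: open_nbhs_nbhs.
move=> /nbhs_ballP[e /= e0 H]; exists e => // h he; apply: H.
by rewrite -ball_normE /= opprD addrA subrr add0r normrN.
Qed.

Lemma general_solution_injective t p q : 0 <= t <= b -> X p -> X q ->
  phi t p = phi t q -> p = q.
Proof.
move=> tb Xp Xq e.
have [p0 tp] := general_solutionP Xp; have [q0 tq] := general_solutionP Xq.
rewrite -p0 -q0.
have zb : (0 : R) <= 0 <= b by rewrite lexx ltW.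
exact: (trajectory_unique openX C1F regv tq tp tb e zb).
Qed.

Lemma general_solution_jacobian p : X p -> exists M : R -> 'M[R]_n,
  [/\ M 0 = 1%:M, primitive_on s 0 b M (fun t => M t *m D1 F (phi t p) (v t)),
      forall t, 0 <= t <= b -> M t \in unitmx,
      forall t, 0 <= t <= b -> 'J (phi t) p = M t
    & forall t (eps : R), 0 <= t <= b -> 0 < eps ->
      exists2 eta : R, 0 < eta & forall h, `|h| < eta ->
        `|phi t (p + h) - phi t p - h *m M t| <= eps * `|h| ].
Proof.
move=> Xp; have [p0 tp] := general_solutionP Xp.
have [M M0 pM] := variational_matrix openX C1F (ltW b0) regv extT tp.
have first_order t (eps : R) : 0 <= t <= b -> 0 < eps ->
      exists2 eta : R, 0 < eta & forall h, `|h| < eta ->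
        `|phi t (p + h) - phi t p - h *m M t| <= eps * `|h|.
  move=> tb e0.
  have [eta eta0 H] := flow_first_order openX C1F (ltW b0) regv tp M0 pM e0.
  have [de de0 Hde] := near_X Xp.
  exists (Num.min eta de); first by rewrite lt_min eta0.
  move=> h; rewrite lt_min => /andP[he hd].
  have [q0 tq] := general_solutionP (Hde _ hd).
  by have := H _ tq; rewrite q0 p0 [p + h]addrC addrK => /(_ he t tb).
exists M; split => //.
  exact: (variational_unit openX C1F (ltW b0) regv tp M0 pM).
by move=> t tb; apply: jacobian_small_o => eps; exact: first_order.
Qed.

Hypothesis C2F : C2_fst X V F.

(** The integral is the quadratic term of the expansion of [phi t] at [p], pulled
    back by the differential; a bound on it therefore bounds the curvature of
    preimages of segments. *)
Lemma general_solution_second_order t p (eps : R) : X p -> 0 <= t <= b ->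
  0 < eps -> exists2 eta : R, 0 < eta & forall h, `|h| < eta ->
  `|phi t (p + h) - phi t p -
    (h + 2^-1 *: vintegral 0 t (fun tau =>
       let k := h *m 'J (phi tau) p in
       k *m D11 F (phi tau p) (v tau) k *m invmx ('J (phi tau) p))) *m
    'J (phi t) p| <= eps * `|h| ^+ 2.
Proof.
move=> Xp tb e0; have [p0 tp] := general_solutionP Xp.
have [M [M0 pM uM JM _]] := general_solution_jacobian Xp.
have [eta eta0 H] :=
  flow_second_order openX C1F (ltW b0) regv C2F tp M0 pM e0.
have [de de0 Hde] := near_X Xp.
exists (Num.min eta de); first by rewrite lt_min eta0.
move=> h; rewrite lt_min => /andP[he hd].
have [q0 tq] := general_solutionP (Hde _ hd).
pose g tau := (h *m M tau) *m D11 F (phi tau p) (v tau) (h *m M tau) *m invmx (M tau).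
have -> : vintegral 0 t (fun tau => let k := h *m 'J (phi tau) p in
       k *m D11 F (phi tau p) (v tau) k *m invmx ('J (phi tau) p)) =
    vintegral 0 t g.
  apply/rowP => j; rewrite !mxE; apply: eq_Rintegral => tau.
  rewrite inE /= in_itv /= => /andP[t0 tt].
  by rewrite JM// t0 (le_trans tt)//; case/andP: tb.
rewrite JM//.
have pg : primitive_on s 0 b (fun t => vintegral 0 t g) g.
  exact: (quadratic_term_primitive openX C1F (ltW b0) regv C2F h tp M0 pM).
have := H _ (fun t => vintegral 0 t g) tq.
by rewrite q0 p0 [p + h]addrC addrK => /(_ he (vintegral0 g) pg t tb).
Qed.

End FlowOfSolutions.

Theorem mainTheorem6 (R : realType) (n m : nat) (n_ge2 : (2 <= n)%N)
    (X : set 'rV[R]_n) (openX : open X) (V : set 'rV[R]_m)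
    (T : R) (T_gt0 : 0 < T) (U : set (R -> 'rV[R]_m))
    (pcU : forall u, U u -> piecewise_continuous V T u)
    (F : 'rV[R]_n -> 'rV[R]_m -> 'rV[R]_n)
    (contF : {within X `*` V,
       continuous (fun z : 'rV[R]_n * 'rV[R]_m => F z.1 z.2)})
    (C1F : C1_fst X V F)
    (extF : forall x0 v, X x0 -> admissible T U v ->
       exists x, is_solution X F x0 v x)
    (C2F : C2_fst X V F)
    (t r : R) (t_gt0 : 0 < t) (r_gt0 : 0 < r)
    (Omega : set 'rV[R]_n) (OmegaX : Omega `<=` X)
    (rconvO : r_convex r Omega) (OmegaT : Omega <> setT)
    (L2 : R) :
  let phi := general_solution X F in
  let D2phi (tau : R) (x : 'rV[R]_n) (v : R -> 'rV[R]_m) : 'M[R]_n :=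
    'J (fun y => phi tau y v) x in
  (forall (x : 'rV[R]_n) (delta : R) (v : R -> 'rV[R]_m) (h : 'rV[R]_n),
     Omega x -> 0 <= delta <= t -> admissible T U v ->
     enorm (vintegral 0 delta (fun tau =>
       let k := h *m D2phi tau x v in
       k *m D11 F (phi tau x v) (v tau) k *m invmx (D2phi tau x v)))
     <= L2 * enorm h ^+ 2) ->
  r * L2 <= 1 ->
  forall (tau : R) (v : R -> 'rV[R]_m),
    0 <= tau <= t -> admissible T U v ->
    convex_set ((fun x => phi tau x v) @` Omega).
Proof.
move=> phi D2phi bound rL2 tau v taut adm.
have [s regv] := admissible_regulated t T_gt0 pcU adm.
have ext p : X p -> exists x, is_solution X F p v x by move=> Xp; exact: extF.
have [C OC] := rconvO; rewrite OC in OmegaX *.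
have C0 : C !=set0.
  apply/set0P/eqP => CE; apply: OmegaT.
  by rewrite OC CE bigcap_set0.
have jac p : X p -> 'J ((fun y => phi tau y v)) p \in unitmx.
  move=> Xp; have [M [_ _ uM JM _]] := general_solution_jacobian openX C1F t_gt0 regv ext Xp.
  by rewrite JM ?uM.
apply: (@convex_image R n X (fun y => phi tau y v) (fun x => D2phi tau x v) openX
  _ _ _ C r L2 (fun x h => vintegral 0 tau (fun tau =>
       let k := h *m D2phi tau x v in
       k *m D11 F (phi tau x v) (v tau) k *m invmx (D2phi tau x v)))) => //.
- by move=> p q Xp Xq; exact: (general_solution_injective openX C1F t_gt0 regv ext taut).
- move=> p eps Xp e0.
  have [M [_ _ _ JM H]] := general_solution_jacobian openX C1F t_gt0 regv ext Xp.
  have [eta eta0 He] := H tau eps taut e0; exists eta => // h /He.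
  by rewrite /D2phi JM.
- move=> p eps /OmegaX Xp e0.
  exact: (general_solution_second_order openX C1F t_gt0 regv ext C2F Xp taut e0).
- by move=> p h Op; apply: bound => //; rewrite OC.
Qed.
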